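(* Let $n\ge 1$, let $a>0$, $b>0$ be constants, and let $f:\mathbb{R}^n\times[0,\infty)\to\mathbb{R}$ be a positive solution of $$f_t=\Delta f+af-bf^3 .$$ Put $l=\log f$. Let $\alpha,\beta,\gamma$ be real constants such that (a) $\alpha>\beta\ge 0$, and (b) $\gamma\le \dfrac{-nb\alpha^2(2\alpha+\beta)}{3n\alpha^2-2(\alpha-\beta)\beta}<0$. (i) If in addition (c) $4\gamma(\alpha-\beta)+n\alpha^2 b<0$, then for all $x\in\mathbb{R}^n$ and $t>0$, $$\alpha\,\Delta l+\beta|\nabla l|^2+\gamma e^{2l}+\varphi(t)\ \ge\ 0,$$ where $$\varphi(t)=\left(\frac{a\alpha}{1-e^{2at}}\right)\left(\frac{\gamma}{\alpha b}e^{2at}-\frac{\alpha\gamma n}{4\gamma(\alpha-\beta)+\alpha^2bn}\right).$$ (ii) If instead of (c) one has (d) $4\gamma(\alpha-\beta)+n\alpha^2 b\ge 0$, then for all $x\in\mathbb{R}^n$ and $t>0$, $$\alpha\,\Delta l+\beta|\nabla l|^2+\gamma e^{2l}+\psi(t)\ \ge\ 0,$$ where, with $$T:=\frac{n\alpha^2}{2(\alpha-\beta)(-a\gamma)}\left(2\left(\frac{\alpha-\beta}{n\alpha^2}\right)\gamma+b\right),$$ $$\psi(t)=\begin{cases}\dfrac{n\alpha^2}{2(\alpha-\beta)t}, & t\le T,\\[2ex] \dfrac{-an\alpha^2\gamma\left(e^{2a(t-T)}+1\right)}{n\alpha^2b\left(e^{2a(t-T)}+1\right)+4\gamma(\alpha-\beta)},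 & t>T.\end{cases}$$
   Context: The equation $f_t=\Delta f+af-bf^3$ is the Newell-Whitehead equation. Subscript $t$ denotes the time derivative; $\nabla$ and $\Delta$ are the gradient and Laplacian in the space variable $x\in\mathbb{R}^n$. ''Solution'' means a classical solution. *)

(* Defs.v *)
From HB Require Import structures.
From mathcomp Require Export all_boot all_order all_algebra.
From mathcomp Require Export all_classical all_reals all_analysis.

Set Implicit Arguments.
Unset Strict Implicit.
Unset Printing Implicit Defensive.

Import Order.TTheory GRing.Theory Num.Theory.
Export numFieldNormedType.Exports.

Local Open Scope classical_set_scope.
Local Open Scope ring_scope.

Definition basis_vec {R : realType} {n : nat} (i : 'I_n) : 'rV[R]_n :=
  delta_mx 0 i.

Definition pderiv {R : realType} {n : nat} (i : 'I_n)
    (u : 'rV[R]_n -> R) (x : 'rV[R]_n) : R :=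
  'D_(basis_vec i) u x.

Definition grad {R : realType} {n : nat} (u : 'rV[R]_n -> R)
    (x : 'rV[R]_n) : 'rV[R]_n :=
  \row_i pderiv i u x.

(* The library norm on row vectors is the sup norm, hence this separate
   squared Euclidean norm. *)
Definition sqnorm2 {R : realType} {n : nat} (v : 'rV[R]_n) : R :=
  \sum_(i < n) v 0 i ^+ 2.

Definition laplacian {R : realType} {n : nat} (u : 'rV[R]_n -> R)
    (x : 'rV[R]_n) : R :=
  \sum_(i < n) pderiv i (pderiv i u) x.

(* Only the values [f x t] with [0 <= t] are meaningful: every clause below
   (and the derivatives at [0 < t], which are local) ignores negative times. *)
Record regular21 {R : realType} {n : nat} (f : 'rV[R]_n -> R -> R) : Prop := {
  regular21_cont :
    {within [set p : 'rV[R]_n * R | 0 <= p.2],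
      continuous (fun p : 'rV[R]_n * R => f p.1 p.2)} ;
  regular21_dt : forall (x : 'rV[R]_n) (t : R), 0 < t -> derivable (f x) t 1 ;
  regular21_dt_cont : forall (x : 'rV[R]_n) (t : R), 0 < t ->
    {for (x, t), continuous (fun p : 'rV[R]_n * R => derive1 (f p.1) p.2)} ;
  regular21_dx : forall (i : 'I_n) (x : 'rV[R]_n) (t : R), 0 < t -> derivable (f^~ t) x (basis_vec i) ;
  regular21_dx_cont : forall (i : 'I_n) (x : 'rV[R]_n) (t : R), 0 < t ->
    {for (x, t),
      continuous (fun p : 'rV[R]_n * R => pderiv i (f^~ p.2) p.1)} ;
  regular21_dxx : forall (i j : 'I_n) (x : 'rV[R]_n) (t : R), 0 < t ->
    derivable (pderiv i (f^~ t)) x (basis_vec j) ;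
  regular21_dxx_cont : forall (i j : 'I_n) (x : 'rV[R]_n) (t : R), 0 < t ->
    {for (x, t),
      continuous (fun p : 'rV[R]_n * R => pderiv j (pderiv i (f^~ p.2)) p.1)}
}.

Definition classical_NW_solution {R : realType} {n : nat} (a b : R)
    (f : 'rV[R]_n -> R -> R) : Prop :=
  regular21 f /\
  forall (x : 'rV[R]_n) (t : R), 0 < t ->
    derive1 (f x) t = laplacian (f^~ t) x + a * f x t - b * f x t ^+ 3.

Definition phi {R : realType} (n : nat) (a b alpha beta gamma t : R) : R :=
  a * alpha / (1 - expR (2 * a * t)) *
  (gamma / (alpha * b) * expR (2 * a * t) -
   alpha * gamma * n%:R /
     (4 * gamma * (alpha - beta) + alpha ^+ 2 * b * n%:R)).

Definition switch_time {R : realType} (n : nat) (a b alpha beta gamma : R) : R :=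
  n%:R * alpha ^+ 2 / (2 * (alpha - beta) * (- (a * gamma))) *
  (2 * ((alpha - beta) / (n%:R * alpha ^+ 2)) * gamma + b).

Definition psi {R : realType} (n : nat) (a b alpha beta gamma t : R) : R :=
  let T := switch_time n a b alpha beta gamma in
  if t <= T then n%:R * alpha ^+ 2 / (2 * (alpha - beta) * t)
  else - (a * n%:R * alpha ^+ 2 * gamma * (expR (2 * a * (t - T)) + 1)) /
       (n%:R * alpha ^+ 2 * b * (expR (2 * a * (t - T)) + 1) +
        4 * gamma * (alpha - beta)).

(* Main.v *)
Require Import Defs.
From mathcomp Require Import ring lra.

(** The idea is the Li-Yau maximum principle for
    [h = alpha Delta l + beta |grad l|^2 + gamma e^(2l) + phi(t)], where
    [l_t = Delta l + |grad l|^2 + a - b e^(2l)].  The Bochner formula and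
    [|Hess l|^2 >= (Delta l)^2 / n] show that [h] cannot have a negative
    interior minimum as soon as [phi] satisfies a Riccati differential
    inequality (see [weight]); the two functions of the theorem do.

    Two difficulties are avoided rather than solved.  A classical solution is
    only twice differentiable in space, so [h] itself cannot be differentiated:
    [Delta l] and [grad l] are replaced by difference quotients of step [s],
    for which the Bochner formula is an exact identity involving only second
    derivatives of [l], and [s] tends to 0 after the minimum point has been
    found.  No bound on the solution is assumed at infinity: adding a barrier
    that blows up on the boundary of a cube localises the minimum, and the
    quadratic terms in the Riccati inequality absorb the barrier.  This needs
    [beta > 0]; the case [beta = 0] follows by perturbing [alpha], [beta] and
    [gamma]. *)

Set Implicit Arguments.
Unset Strict Implicit.
Unset Printing Implicit Defensive.

Import Order.TTheory GRing.Theory Num.Theory.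

Local Open Scope classical_set_scope.
Local Open Scope ring_scope.

(** * Algebraic inequalities *)


(** The constants come from one computation. With [c = 2 (alpha - beta) / (n alpha^2)], the Hessian
    term dominates [c (alpha Delta l)^2]; eliminating [alpha Delta l] through the value of [h]
    produces a multiple of [e^(2l) |grad l|^2], and hypothesis (b) says exactly that its coefficient
    is nonnegative. What is left is a quadratic polynomial in [w = e^(2l)], and the derivative of
    [phi] has to compensate its minimum. The minimum over all real [w] gives a Riccati equation,
    solved by the function of case (i) and by the late branch of [psi]; when the minimum over
    [w >= 0] sits at [w = 0], the equation is [phi' = - c phi^2], solved by [1 / (c t)]. The
    switching time is where the minimiser leaves [w = 0]. Conditions (c) and (d) are the two signs
    of [2 c gamma + b]. The minimum point depends on the step [s], so no limit is taken along it: by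
    compactness, for all small [s] no point of the cylinder can satisfy what a minimum would have to
    satisfy. *)

Lemma sqr_sum_le (R : realFieldType) (n : nat) (q : 'I_n -> R) :
  (\sum_i q i) ^+ 2 <= n%:R * \sum_i q i ^+ 2.
Proof.
elim: n q => [|n IH] q; first by rewrite !big_ord0 expr0n mul0r.
rewrite !big_ord_recr /=; set q' := fun i => q (widen_ord (leqnSn n) i).
have := IH q'; rewrite /q'; set S := \sum_(i < n) _; set T := \sum_(i < n) _.
set x := q ord_max => h.
have hx : 2 * x * S <= T + n%:R * x ^+ 2.
  have -> : T + n%:R * x ^+ 2 = \sum_(i < n) (q' i ^+ 2 + x ^+ 2).
    by rewrite big_split /= sumr_const card_ord -[X in _ = _ + X]mulr_natl.
  rewrite /S mulr_sumr; apply: ler_sum => i _.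
  by have := sqr_ge0 (q' i - x); rewrite /q'; nra.
rewrite -natr1; nra.
Qed.

(** This lets one-dimensional barriers, each controlled by its own square, be added over the
    coordinates. *)
Lemma sum_sqr_le (R : realFieldType) (n : nat) (z : 'I_n -> R) :
  (forall i, 0 <= z i) -> \sum_i z i ^+ 2 <= (\sum_i z i) ^+ 2.
Proof.
move=> z0; rewrite [leRHS]expr2 mulr_suml; apply: ler_sum => i _.
rewrite expr2; apply: ler_wpM2l => //.
by rewrite (bigD1 i) //= lerDl; apply: sumr_ge0.
Qed.

(** The continuous Harnack computation at a point where [h = - N] with [N]
    dominating the barrier [z]: [c2 * N ^+ 2 - (...)] is the lower bound on the
    time derivative of [phi] provided by [weight_ode].  The gradient of the barrier
    is absorbed by [2 c be z |p|^2], hence the need for [0 < be]. *)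
Lemma pointwise_positive (R : realFieldType) (n : nat)
    (a b al be ga c c2 phi w N del : R) (p q z z1 z2 : 'I_n -> R) :
  0 < b -> 0 < be -> 0 < c -> 0 < c2 -> 0 <= phi -> 0 < w -> 0 < del ->
  c * al ^+ 2 * n%:R = 2 * (al - be) ->
  0 <= 2 * c * be * ga - 4 * b * al - 2 * b * be - 6 * ga ->
  al * \sum_i q i + be * \sum_i p i ^+ 2 + ga * w + phi = - N ->
  \sum_i z i + del <= N ->
  (forall i, 0 < z i) ->
  (forall i, z2 i + z1 i ^+ 2 / (2 * c * be * z i) <= c2 * z i ^+ 2) ->
  0 < 2 * (al - be) * \sum_i q i ^+ 2
      - b * (al * w * (2 * \sum_i q i + 4 * \sum_i p i ^+ 2)
             + 4 * be * w * \sum_i p i ^+ 2)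
      + ga * (- 6 * w * \sum_i p i ^+ 2 + 2 * a * w - 2 * b * w ^+ 2)
      - \sum_i z2 i - 2 * \sum_i p i * z1 i
      + (c2 * N ^+ 2 - (c * (phi + N + ga * w) ^+ 2 + 2 * b * w * (phi + N)
                        + 2 * a * ga * w)).
Proof.
move=> b0 be0 c0 c20 phi0 w0 del0 hc hk hN zN z0 hz.
have hq := sqr_sum_le q.
set Q2 := \sum_i q i ^+ 2 in hq *; set S := \sum_i q i in hq hN *.
have y0 : 0 <= \sum_i p i ^+ 2 by apply: sumr_ge0 => i _; apply: sqr_ge0.
(* Coordinatewise, [2 * p * z1 <= 2 * c * be * z * p ^+ 2 + z1 ^+ 2 / (2 * c * be * z)]; the last
   term is the one that [hz] pays for. *)
have hb : \sum_i z2 i + 2 * \sum_i p i * z1 i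
    <= c2 * (\sum_i z i) ^+ 2 + 2 * c * be * (\sum_i z i) * \sum_i p i ^+ 2.
  have h1 : \sum_i z2 i + 2 * \sum_i p i * z1 i <=
      \sum_i (c2 * z i ^+ 2 + 2 * c * be * (z i * p i ^+ 2)).
    rewrite mulr_sumr -big_split /=; apply: ler_sum => i _.
    have := hz i; have zi := z0 i.
    have : 0 <= (2 * c * be * z i * p i - z1 i) ^+ 2 / (2 * c * be * z i).
      by apply: divr_ge0; rewrite ?sqr_ge0 // ltW // !mulr_gt0.
    have -> : (2 * c * be * z i * p i - z1 i) ^+ 2 / (2 * c * be * z i)
      = 2 * c * be * (z i * p i ^+ 2) - 2 * (p i * z1 i)
        + z1 i ^+ 2 / (2 * c * be * z i).
      by field; rewrite !gt_eqF.
    lra.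
  apply: le_trans h1 _; rewrite big_split /= -!mulr_sumr; apply: lerD.
    by rewrite ler_pM2l //; apply: sum_sqr_le => i; apply: ltW.
  rewrite -[leRHS]mulrA ler_pM2l ?mulr_gt0 // mulr_sumr; apply: ler_sum => i _.
  apply: ler_wpM2r; first exact: sqr_ge0.
  by rewrite (bigD1 i) //= lerDl; apply: sumr_ge0 => j _; apply: ltW.
have Z0 : 0 <= \sum_i z i by apply: sumr_ge0 => j _; apply: ltW.
set y := \sum_i p i ^+ 2 in y0 hN hb *; set Z := \sum_i z i in zN hb Z0 *.
set A2 := \sum_i z2 i in hb *; set A1 := \sum_i p i * z1 i in hb *.
have N0 : 0 < N by lra.
(* Cauchy-Schwarz; [hc] is the normalisation that makes [c] the constant in front of
   [(al * S) ^+ 2]. *)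
have h1 : c * (al * S) ^+ 2 <= 2 * (al - be) * Q2.
  rewrite -hc.
  have -> : c * al ^+ 2 * n%:R * Q2 = (c * al ^+ 2) * (n%:R * Q2) by ring.
  have -> : c * (al * S) ^+ 2 = (c * al ^+ 2) * S ^+ 2 by ring.
  by apply: ler_wpM2l => //; apply: mulr_ge0; rewrite ?sqr_ge0 // ltW.
have hS : al * S = - (phi + N + be * y + ga * w) by lra.
have h2 : c2 * Z ^+ 2 < c2 * N ^+ 2.
  by rewrite ltr_pM2l // !expr2; nra.
have h3 : 2 * c * be * Z * y <= 2 * c * be * (phi + N) * y.
  apply: ler_wpM2r => //; apply: ler_wpM2l; last by lra.
  by rewrite ltW // !mulr_gt0.
(* This is the total coefficient of [w * y] once [al * S] has been eliminated by [hS]. *)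
have h4 : 0 <= (2 * c * be * ga - 4 * b * al - 2 * b * be - 6 * ga) * (w * y).
  by apply: mulr_ge0 => //; apply: mulr_ge0 => //; apply: ltW.
have h5 : 0 <= c * be ^+ 2 * y ^+ 2.
  by apply: mulr_ge0; rewrite ?sqr_ge0 // mulr_ge0 ?sqr_ge0 // ltW.
rewrite hS in h1.
have -> : al * w * (2 * S + 4 * y) = 2 * w * (al * S) + 4 * al * w * y by ring.
rewrite hS; nra.
Qed.


(** [d k], [e k], [Q k], [W k], [T k] stand for the difference quotient of [l] towards
    the neighbour [k], its gradient, and the values at that neighbour of the pure
    second derivatives, of [e^(2l)] and of [l_t].  The conclusion is the time
    condition minus the sum of the second order conditions minus
    [2 grad l] times the first order conditions; it is exact because
    [|u|^2 - |v|^2 = 2 v.(u - v) + |u - v|^2]. *)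
Lemma discrete_bochner (R : realFieldType) (n : nat) (K : finType)
    (a b al be ga s w tau f1 : R) (d W T : K -> R) (e Q : K -> 'I_n -> R)
    (p q z1 z2 : 'I_n -> R) :
  s != 0 ->
  tau = \sum_j (q j + p j ^+ 2) + a - b * w ->
  (forall k, T k = \sum_j (Q k j + (p j + s * e k j) ^+ 2) + a - b * W k) ->
  \sum_k (al / s + be * d k) * ((T k - tau) / s) + ga * (2 * w * tau) + f1 <= 0 ->
  (forall j, \sum_k (al / s + be * d k) * e k j + ga * (2 * w * p j) + z1 j = 0) ->
  (forall j, 0 <= \sum_k ((al / s + be * d k) * ((Q k j - q j) / s)
                         + be * e k j ^+ 2)
     + ga * (2 * w * q j + 4 * w * p j ^+ 2) + z2 j) ->
  \sum_k (al - be + s * be * d k) * (\sum_j e k j ^+ 2)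
    - b * \sum_k (al / s + be * d k) * ((W k - w) / s)
    + ga * (- 6 * w * \sum_j p j ^+ 2 + 2 * a * w - 2 * b * w ^+ 2)
    - \sum_j z2 j - 2 * \sum_j p j * z1 j + f1 <= 0.
Proof.
move=> s0 htau hT hTime hG hS.
have : 0 <= \sum_j (\sum_k ((al / s + be * d k) * ((Q k j - q j) / s)
                         + be * e k j ^+ 2)
     + ga * (2 * w * q j + 4 * w * p j ^+ 2) + z2 j
     + 2 * p j * (\sum_k (al / s + be * d k) * e k j
        + ga * (2 * w * p j) + z1 j)).
  by apply: sumr_ge0 => j _; rewrite hG mulr0 addr0; apply: hS.
have -> : \sum_j (\sum_k ((al / s + be * d k) * ((Q k j - q j) / s)
                         + be * e k j ^+ 2)
     + ga * (2 * w * q j + 4 * w * p j ^+ 2) + z2 j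
     + 2 * p j * (\sum_k (al / s + be * d k) * e k j
        + ga * (2 * w * p j) + z1 j)) =
   \sum_k \sum_j ((al / s + be * d k) * ((Q k j - q j) / s + 2 * p j * e k j)
     + be * e k j ^+ 2)
   + \sum_j (ga * (2 * w * q j + 4 * w * p j ^+ 2) + z2 j
      + 2 * p j * (ga * (2 * w * p j) + z1 j)).
  rewrite exchange_big /= -big_split /=; apply: eq_bigr => j _.
  have -> : \sum_k ((al / s + be * d k) * ((Q k j - q j) / s + 2 * p j * e k j)
       + be * e k j ^+ 2)
    = \sum_k ((al / s + be * d k) * ((Q k j - q j) / s) + be * e k j ^+ 2)
      + 2 * p j * \sum_k (al / s + be * d k) * e k j.
    by rewrite mulr_sumr -big_split /=; apply: eq_bigr => k _; ring.
  by ring.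
move=> hS'.
have hk : forall k, (al / s + be * d k) * ((T k - tau) / s) =
   \sum_j ((al / s + be * d k) * ((Q k j - q j) / s + 2 * p j * e k j)
     + be * e k j ^+ 2)
   + (al - be + s * be * d k) * (\sum_j e k j ^+ 2)
   - b * ((al / s + be * d k) * ((W k - w) / s)).
  move=> k; rewrite hT htau.
  have -> : \sum_j ((al / s + be * d k) * ((Q k j - q j) / s + 2 * p j * e k j)
      + be * e k j ^+ 2) =
    (al / s + be * d k) * \sum_j ((Q k j - q j) / s + 2 * p j * e k j)
      + be * \sum_j e k j ^+ 2.
    by rewrite !mulr_sumr -big_split.
  have -> : \sum_j ((Q k j - q j) / s + 2 * p j * e k j) =
      (\sum_j (Q k j + (p j + s * e k j) ^+ 2) - \sum_j (q j + p j ^+ 2)) / s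
      - s * \sum_j e k j ^+ 2.
    rewrite -sumrB mulr_suml [s * _]mulr_sumr -sumrB.
    by apply: eq_bigr => j _; field.
  by field.
rewrite (eq_bigr _ (fun k _ => hk k)) big_split /= sumrN -mulr_sumr in hTime.
rewrite big_split /= in hTime.
have hA : \sum_j (ga * (2 * w * q j + 4 * w * p j ^+ 2) + z2 j
      + 2 * p j * (ga * (2 * w * p j) + z1 j)) =
   ga * (2 * w * \sum_j (q j + p j ^+ 2)) + 6 * ga * w * \sum_j p j ^+ 2
   + \sum_j z2 j + 2 * \sum_j p j * z1 j.
  rewrite !mulr_sumr -!big_split /=; apply: eq_bigr => j _; ring.
rewrite hA in hS'; rewrite htau in hTime.
lra.
Qed.

(** * Calculus on the line *)

Lemma is_derive_quotient (R : realType) (g : R -> R) (x D : R) :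
  is_derive x 1 g D -> forall eps, 0 < eps -> exists2 rho, 0 < rho &
    forall h, h != 0 -> `|h| < rho -> `|(g (x + h) - g x) / h - D| < eps.
Proof.
move=> gD eps eps0.
have /cvgr_dist_lt/(_ _ eps0) : (fun h : R => h^-1 *: ((g \o shift x) (h *: 1) - g x)) @ 0^' --> D.
  have [+ <-] := gD; exact.
move=> [rho /= rho0 H]; exists rho => // h h0 hrho.
have := H h; rewrite /= sub0r normrN distrC => /(_ hrho h0).
by rewrite /GRing.scale /= mulr1 (addrC h) mulrC.
Qed.

Lemma mvt (R : realType) (g g1 : R -> R) (A B : R) : A < B ->
  (forall r, A <= r <= B -> is_derive r 1 g (g1 r)) ->
  exists2 r, A < r < B & g B - g A = g1 r * (B - A).
Proof.
move=> AB gD.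
have [||r rI E] := @MVT R g g1 A B AB.
- move=> r; rewrite in_itv /= => /andP[r1 r2]; apply: gD; by rewrite !ltW.
- apply: derivable_within_continuous => r; rewrite in_itv /= => /gD.
  by move=> [].
by exists r => //; move: rI; rewrite in_itv.
Qed.

(** The mean value theorem is applied twice, first to [g r + g (- r) - m * r ^+ 2] on [[0, s]], then
    to [g1] on the symmetric interval [[- r, r]], so no continuity of [g2] is needed. *)
Lemma second_difference_ge (R : realType) (g g1 g2 : R -> R) (s m : R) :
  (forall r : R, is_derive r 1 g (g1 r)) -> (forall r : R, is_derive r 1 g1 (g2 r)) ->
  0 < s -> (forall r, `|r| <= s -> m <= g2 r) ->
  m * s ^+ 2 <= g s + g (- s) - 2 * g 0.
Proof.
move=> gD g1D s0 hm.
pose k r := g r + g (- r) - m * r ^+ 2.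
have kD (r : R) : is_derive r 1 k (g1 r - g1 (- r) - m * (2 * r)).
  have h1 : is_derive r 1 (fun r : R => g (- r)) (- g1 (- r)).
    have h2 : is_derive (- r) 1 g (g1 (- r)) by apply: gD.
    have h3 : is_derive r 1 (-%R : R -> R) (- 1 : R) by apply: is_deriveNid.
    by apply: is_derive_eq; rewrite mulrN1.
  have h0 := gD r.
  rewrite /k; apply: is_derive_eq.
  by rewrite /GRing.scale /=; ring.
have [r /andP[r0 rs] hk] := mvt s0 (fun r _ => kD r).
have [r' /andP[r1 r2] hr'] : exists2 r', - r < r' < r &
    g1 r - g1 (- r) = g2 r' * (r - (- r)).
  have rr : - r < r by lra.
  by apply: (mvt rr) => r' _; apply: g1D.
have hm' : m <= g2 r' by apply: hm; rewrite ler_norml; apply/andP; split; lra.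
move: hk; rewrite /k hr' oppr0 expr0n /= mulr0 subr0.
have : 0 <= (g2 r' * (r - - r) - m * (2 * r)) * s.
  by apply: mulr_ge0; [nra | lra].
by lra.
Qed.

Lemma min_derive0 (R : realType) (g : R -> R) (D rho : R) : 0 < rho ->
  is_derive (0 : R) 1 g D -> (forall r, `|r| < rho -> g 0 <= g r) -> D = 0.
Proof.
move=> rho0 gD gmin; apply/eqP; apply: contraT => D0.
have D0' : 0 < `|D| by rewrite normr_gt0.
have [rho' rho'0 H] := is_derive_quotient gD D0'.
pose h := Num.min rho rho' / 2.
have h0 : 0 < h by rewrite divr_gt0 // lt_min rho0.
have hm : h < Num.min rho rho' by move: h0; rewrite /h; lra.
move: hm; rewrite lt_min => /andP[hr hr'].
have [D1|D1] := ltP D 0.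
  have := H h (lt0r_neq0 h0); rewrite gtr0_norm // => /(_ hr').
  rewrite add0r (ltr0_norm D1) ltr_norml => /andP[_ H1].
  have : (g h - g 0) / h < 0 by lra.
  rewrite ltr_pdivrMr // mul0r subr_lt0 ltNge gmin // gtr0_norm //.
have D2 : 0 < D by rewrite lt_def D0.
have hn0 : - h != 0 by rewrite oppr_eq0 gt_eqF.
have := H (- h) hn0; rewrite normrN gtr0_norm // => /(_ hr').
rewrite add0r (gtr0_norm D2) ltr_norml => /andP[H1 _].
have : 0 < (g (- h) - g 0) / (- h) by lra.
rewrite ltr_ndivlMr ?oppr_lt0 // mul0r subr_lt0 ltNge gmin // normrN gtr0_norm //.
Qed.

Lemma min_derive2_ge0 (R : realType) (g g1 : R -> R) (D rho : R) : 0 < rho ->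
  (forall r : R, `|r| < rho -> is_derive r 1 g (g1 r)) -> is_derive (0 : R) 1 g1 D ->
  (forall r, `|r| < rho -> g 0 <= g r) -> 0 <= D.
Proof.
move=> rho0 gD g1D gmin.
have g10 : g1 0 = 0.
  by apply: (min_derive0 rho0 _ gmin); apply: gD; rewrite normr0.
rewrite leNgt; apply/negP => D0.
have D0' : 0 < - D by lra.
have [rho' rho'0 H] := is_derive_quotient g1D D0'.
pose h := Num.min rho rho' / 2.
have h0 : 0 < h by rewrite divr_gt0 // lt_min rho0.
have hm : h < Num.min rho rho' by move: h0; rewrite /h; lra.
move: hm; rewrite lt_min => /andP[hr hr'].
have [r /andP[r0 rh] E] : exists2 r, 0 < r < h & g h - g 0 = g1 r * (h - 0).
  apply: mvt => // r /andP[r0 rh]; apply: gD; rewrite ger0_norm //; lra.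
have := H r (lt0r_neq0 r0); rewrite gtr0_norm // => /(_ (lt_trans rh hr')).
rewrite add0r g10 subr0 ltr_norml => /andP[_ H1].
have : g1 r / r < 0 by lra.
rewrite ltr_pdivrMr // mul0r => g1r.
have : g 0 <= g h by apply: gmin; rewrite gtr0_norm.
nra.
Qed.

(** One-sided on purpose: the space-time minimum may lie at the final time of the cylinder, where
    only earlier times can be compared. *)
Lemma left_min_derive_le0 (R : realType) (g : R -> R) (t D rho : R) : 0 < rho ->
  is_derive t 1 g D -> (forall r, t - rho < r < t -> g t <= g r) -> D <= 0.
Proof.
move=> rho0 gD gmin; rewrite leNgt; apply/negP => D0.
have [rho' rho'0 H] := is_derive_quotient gD D0.
pose h := Num.min rho rho' / 2.
have h0 : 0 < h by rewrite divr_gt0 // lt_min rho0.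
have hm : h < Num.min rho rho' by move: h0; rewrite /h; lra.
move: hm; rewrite lt_min => /andP[hr hr'].
have hn0 : - h != 0 by rewrite oppr_eq0 gt_eqF.
have := H (- h) hn0; rewrite normrN gtr0_norm // => /(_ hr').
rewrite ltr_norml => /andP[H1 _].
have : 0 < (g (t - h) - g t) / (- h) by lra.
rewrite ltr_ndivlMr ?oppr_lt0 // mul0r subr_lt0 ltNge gmin //.
by apply/andP; split; lra.
Qed.

(** * Difference quotients along lines *)

Definition line_derivative (R : realType) (V : normedModType R)
    (u u1 : V -> R) (e : V) : Prop :=
  forall (x : V) (r : R),
    is_derive r 1 (fun r : R => u (x + r *: e)) (u1 (x + r *: e)).

(** Space-time point tending to [z] while the step tends to [0^+], jointly:
    the minimum point is allowed to move with the step. *)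
Definition near0p (R : realType) (V : normedModType R) (z : V * R) :
    set_system ((V * R) * R) :=
  filter_prod (nbhs z) (0^'+).

#[global] Instance near0p_filter (R : realType) (V : normedModType R) (z : V * R) :
  ProperFilter (near0p z).
Proof. exact: filter_prod_proper. Qed.

Lemma near0p_segment (R : realType) (V : normedModType R) (z : V * R) (e : V)
    (U : set (V * R)) : nbhs z U ->
  \forall zs \near near0p z, 0 < zs.2 /\
    forall r, `|r| <= zs.2 -> U (zs.1.1 + r *: e, zs.1.2).
Proof.
move=> zU.
have cont : (fun zr : (V * R) * R => (zr.1.1 + zr.2 *: e, zr.1.2)) @
    filter_prod (nbhs z) (nbhs (0 : R)) --> z.
  rewrite [X in _ --> X](_ : z = (z.1 + 0 *: e, z.2)); last first.
    by rewrite scale0r addr0; case: z zU.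
  have h1 : (zr.1.1 + zr.2 *: e) @[zr --> filter_prod (nbhs z) (nbhs (0 : R))]
      --> z.1 + 0 *: e.
    apply: cvgD; last by apply: cvgZr_tmp; exact: cvg_snd.
    exact: (cvg_comp (@fst (V * R) R) (@fst V R) cvg_fst cvg_fst).
  have h2 : zr.1.2 @[zr --> filter_prod (nbhs z) (nbhs (0 : R))] --> z.2.
    exact: (cvg_comp (@fst (V * R) R) (@snd V R) cvg_fst cvg_snd).
  exact: (cvg_pair h1 h2).
have /cont [[A B] [/= zA [rho /= rho0 hB]] hAB] := zU.
exists (A, [set s : R | 0 < s < rho]) => /=.
  split => //; exists rho => // s /=.
  by rewrite sub0r normrN => + s0; rewrite s0 gtr0_norm.
move=> [[x t] s] /= [xA /andP[s0 srho]]; split => // r rs.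
apply: (hAB ((x, t), r)); split => //=; apply: hB => /=.
by rewrite sub0r normrN; apply: le_lt_trans srho.
Qed.

Lemma near0p_time (R : realType) (V : normedModType R) (z : V * R) (t0 : R) :
  t0 < z.2 -> \forall zs \near near0p z, t0 < zs.1.2.
Proof.
move=> tz; have : nbhs z [set y : V * R | t0 < y.2].
  have : nbhs z.2 [set t : R | t0 < t] by apply: lt_nbhsr.
  by move/(@cvg_snd V R (nbhs z.1) (nbhs z.2) _); case: z tz.
move=> h; apply: filterS (near0p_segment 0 h) => zs [s0 H].
by have := H 0; rewrite normr0 => /(_ (ltW s0)).
Qed.

Lemma near0p_fst (R : realType) (V : normedModType R) (z : V * R) (u : V * R -> R) :
  {for z, continuous u} -> u zs.1 @[zs --> near0p z] --> u z.
Proof.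
move=> cu; exact: (cvg_comp (fst : (V * R) * R -> V * R) u cvg_fst cu).
Qed.

Lemma near0p_snd (R : realType) (V : normedModType R) (z : V * R) :
  zs.2 @[zs --> near0p z] --> (0 : R).
Proof.
have h : 0^'+ --> (0 : R) by exact: cvg_at_right_filter.
exact: (cvg_comp (snd : (V * R) * R -> R) id cvg_snd h).
Qed.

Section Differences.
Context (R : realType) (V : normedModType R) (u u1 u2 : V -> R -> R) (e : V).
Context (t0 : R) (z : V * R) (tz : t0 < z.2).
Context (uD : forall t, t0 < t -> line_derivative (u^~ t) (u1^~ t) e).

Let dist_bound (g : (V * R) * R -> R) (l : R) :
  (forall eps, 0 < eps -> \forall zs \near near0p z, `|g zs - l| <= eps) ->
  g @ near0p z --> l.
Proof.
move=> H; apply/cvgrPdist_le => eps eps0; apply: filterS (H _ eps0) => zs.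
by rewrite distrC.
Qed.

Lemma forward_difference_cvg : {for z, continuous (fun y => u1 y.1 y.2)} ->
  (u (zs.1.1 + zs.2 *: e) zs.1.2 - u zs.1.1 zs.1.2) / zs.2
    @[zs --> near0p z] --> u1 z.1 z.2.
Proof.
move=> cu1; apply: dist_bound => eps eps0.
have /cvgrPdist_le/(_ _ eps0)/(near0p_segment e) := cu1.
have := near0p_time tz; apply: filterS2 => -[[x t] s] /= ht [s0 H].
have [r /andP[r0 rs]] := mvt s0 (fun r _ => uD ht x r).
rewrite scale0r addr0 subr0 => ->; rewrite mulfK ?gt_eqF // distrC.
by apply: (H r); rewrite gtr0_norm // ltW.
Qed.

Lemma backward_difference_cvg : {for z, continuous (fun y => u1 y.1 y.2)} ->
  (u (zs.1.1 - zs.2 *: e) zs.1.2 - u zs.1.1 zs.1.2) / zs.2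
    @[zs --> near0p z] --> - u1 z.1 z.2.
Proof.
move=> cu1; apply: dist_bound => eps eps0.
have /cvgrPdist_le/(_ _ eps0)/(near0p_segment e) := cu1.
have := near0p_time tz; apply: filterS2 => -[[x t] s] /= ht [s0 H].
have s0' : - s < 0 by lra.
have [r /andP[r0 rs]] := mvt s0' (fun r _ => uD ht x r).
rewrite scale0r addr0 scaleNr sub0r opprK -opprB => /eqP.
rewrite eqr_oppLR => /eqP ->; rewrite mulNr mulfK ?gt_eqF // opprK addrC.
by apply: (H r); rewrite ltr0_norm // lerNl ltW.
Qed.

Context (u1D : forall t, t0 < t -> line_derivative (u1^~ t) (u2^~ t) e).

Lemma second_difference_near (m : R) (U : set (V * R)) : nbhs z U ->
  (forall y, U y -> m <= u2 y.1 y.2) ->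
  \forall zs \near near0p z,
    m <= (u (zs.1.1 + zs.2 *: e) zs.1.2 + u (zs.1.1 - zs.2 *: e) zs.1.2
          - 2 * u zs.1.1 zs.1.2) / zs.2 ^+ 2.
Proof.
move=> zU hm; have := near0p_time tz.
have := near0p_segment e zU; apply: filterS2 => -[[x t] s] /= [s0 H] ht.
rewrite ler_pdivlMr ?exprn_gt0 //.
have := @second_difference_ge R (fun r => u (x + r *: e) t)
  (fun r => u1 (x + r *: e) t) (fun r => u2 (x + r *: e) t) s m
  (uD ht x) (u1D ht x) s0.
rewrite scale0r addr0 scaleNr; apply => r rs.
by apply: (hm (x + r *: e, t)); exact: H.
Qed.

End Differences.

Lemma second_difference_cvg (R : realType) (V : normedModType R)
    (u u1 u2 : V -> R -> R) (e : V) (t0 : R) (z : V * R) : t0 < z.2 ->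
  (forall t, t0 < t -> line_derivative (u^~ t) (u1^~ t) e) ->
  (forall t, t0 < t -> line_derivative (u1^~ t) (u2^~ t) e) ->
  {for z, continuous (fun y => u2 y.1 y.2)} ->
  (u (zs.1.1 + zs.2 *: e) zs.1.2 + u (zs.1.1 - zs.2 *: e) zs.1.2
          - 2 * u zs.1.1 zs.1.2) / zs.2 ^+ 2
    @[zs --> near0p z] --> u2 z.1 z.2.
Proof.
move=> tz uD u1D cu2; apply/cvgrPdist_le => eps eps0.
have /cvgrPdist_le/(_ _ eps0) hU := cu2.
(* The one-sided estimate applied to [- u] supplies the upper bound. *)
have opp (v v1 : V -> R -> R) (t : R) : line_derivative (v^~ t) (v1^~ t) e ->
    line_derivative ((fun x t => - v x t)^~ t) ((fun x t => - v1 x t)^~ t) e.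
  by move=> vD x r; have := vD x r => h; apply: is_deriveN.
have := second_difference_near tz uD u1D hU (m := u2 z.1 z.2 - eps).
have := second_difference_near tz (fun t ht => opp _ _ _ (uD t ht))
  (fun t ht => opp _ _ _ (u1D t ht)) hU (m := - u2 z.1 z.2 - eps).
move=> /(_ _)H1 /(_ _)H2.
have {}H1 := H1 (fun y hy => ltac:(move: hy; rewrite /= ler_norml => /andP[]; lra)).
have {}H2 := H2 (fun y hy => ltac:(move: hy; rewrite /= ler_norml => /andP[]; lra)).
move: H1 H2; apply: filterS2 => -[[x t] s] /=.
set D := (u _ _ + u _ _ - 2 * u _ _) / _.
rewrite (_ : (_ - _ - _) / _ = - D); last by rewrite /D; ring.
by move=> h1 h2; rewrite ler_norml; apply/andP; split; lra.
Qed.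

(** * The discretised Harnack quantity *)

Lemma is_derive_finsum (R : realType) (K : finType) (h : K -> R -> R)
    (dh : K -> R) (x : R) : (forall k, is_derive x 1 (h k) (dh k)) ->
  is_derive x 1 (fun y => \sum_k h k y) (\sum_k dh k).
Proof.
move=> hD.
rewrite (_ : (fun y => _) = \sum_k h k); last first.
  by apply/funext => y; rewrite fct_sumE.
by elim/big_ind2 : _ => // [|] *; [exact: is_derive_cst|exact: is_deriveD].
Qed.

Lemma is_derive_expR2 (R : realType) (L : R -> R) (r P : R) :
  is_derive r 1 L P ->
  is_derive r 1 (fun r => expR (2 * L r)) (2 * expR (2 * L r) * P).
Proof.
move=> LD.
have h : is_derive r 1 (fun r => 2 * L r) (2 * P).
  by apply: is_derive_eq; rewrite /GRing.scale /=; ring.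
have h2 : is_derive r 1 (expR \o (fun r => 2 * L r)) (expR (2 * L r) * (2 * P)).
  by apply: is_derive1_comp.
by apply: (is_derive_eq h2); ring.
Qed.

(** The discretisation of [al Delta l + be |grad l|^2 + ga e^(2l)]; [k] ranges over
    the [2n] neighbours at distance [s], so first order terms cancel in pairs and
    each square is counted twice. *)
Definition energy (R : realType) (K : finType) (al be ga s L : R) (Lk : K -> R) : R :=
  \sum_k (al / s * ((Lk k - L) / s) + be / 2 * ((Lk k - L) / s) ^+ 2)
  + ga * expR (2 * L).

Lemma energy_is_derive (R : realType) (K : finType) (al be ga s : R)
    (L : R -> R) (Lk : K -> R -> R) (r P : R) (Pk : K -> R) :
  is_derive r 1 L P -> (forall k, is_derive r 1 (Lk k) (Pk k)) ->
  is_derive r 1 (fun r => energy al be ga s (L r) (Lk ^~ r))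
    (\sum_k (al / s + be * ((Lk k r - L r) / s)) * ((Pk k - P) / s)
     + ga * (2 * expR (2 * L r) * P)).
Proof.
move=> LD LkD.
have h k : is_derive r 1 (fun r => al / s * ((Lk k r - L r) / s)
      + be / 2 * ((Lk k r - L r) / s) ^+ 2)
    ((al / s + be * ((Lk k r - L r) / s)) * ((Pk k - P) / s)).
  have h0 := LkD k.
  have h1 : is_derive r 1 (fun r => (Lk k r - L r) / s) ((Pk k - P) / s).
    rewrite (_ : (fun r => _) = s^-1 \*: (Lk k - L)).
      by apply: is_derive_eq; rewrite /GRing.scale /= mulrC.
    by apply/funext => y; rewrite /GRing.scale /= mulrC.
  by apply: is_derive_eq; rewrite /GRing.scale /=; move: (s^-1) => si; field.
have h1 := is_derive_finsum h.
have h2 := is_derive_expR2 LD.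
by apply: is_derive_eq; rewrite /GRing.scale /=.
Qed.

Lemma energy_is_derive2 (R : realType) (K : finType) (al be ga s : R)
    (L P : R -> R) (Lk Pk : K -> R -> R) (r Q : R) (Qk : K -> R) :
  is_derive r 1 L (P r) -> (forall k, is_derive r 1 (Lk k) (Pk k r)) ->
  is_derive r 1 P Q -> (forall k, is_derive r 1 (Pk k) (Qk k)) ->
  is_derive r 1 (fun r =>
      \sum_k (al / s + be * ((Lk k r - L r) / s)) * ((Pk k r - P r) / s)
      + ga * (2 * expR (2 * L r) * P r))
    (\sum_k ((al / s + be * ((Lk k r - L r) / s)) * ((Qk k - Q) / s)
             + be * ((Pk k r - P r) / s) ^+ 2)
     + ga * (2 * expR (2 * L r) * Q + 4 * expR (2 * L r) * P r ^+ 2)).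
Proof.
move=> LD LkD PD PkD.
have aux (A B : R -> R) (A1 B1 : R) : is_derive r 1 A A1 -> is_derive r 1 B B1 ->
    is_derive r 1 (fun r => (A r - B r) / s) ((A1 - B1) / s).
  move=> h1 h2; rewrite (_ : (fun r => _) = s^-1 \*: (A - B)).
    by apply: is_derive_eq; rewrite /GRing.scale /= mulrC.
  by apply/funext => y; rewrite /GRing.scale /= mulrC.
have h k : is_derive r 1
    (fun r => (al / s + be * ((Lk k r - L r) / s)) * ((Pk k r - P r) / s))
    ((al / s + be * ((Lk k r - L r) / s)) * ((Qk k - Q) / s)
             + be * ((Pk k r - P r) / s) ^+ 2).
  have h1 := aux _ _ _ _ (LkD k) LD; have h2 := aux _ _ _ _ (PkD k) PD.
  by apply: is_derive_eq; rewrite /GRing.scale /=; ring.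
have h1 := is_derive_finsum h.
have h2 := is_derive_expR2 LD.
by apply: is_derive_eq; rewrite /GRing.scale /=; ring.
Qed.

(** [tau], [p i], [q i] are the derivatives [l_t], [l_(x_i)], [l_(x_i x_i)];
    mixed second derivatives are never needed. *)
Record log_solution (R : realType) (n : nat) (a b t0 : R)
    (l tau : 'rV[R]_n -> R -> R) (p q : 'I_n -> 'rV[R]_n -> R -> R) : Prop := {
  ls_dx : forall i t, t0 < t -> line_derivative (l^~ t) (p i ^~ t) (basis_vec i) ;
  ls_dxx : forall i t, t0 < t -> line_derivative (p i ^~ t) (q i ^~ t) (basis_vec i) ;
  ls_dt : forall x t, t0 < t -> is_derive t 1 (l x) (tau x t) ;
  ls_cont : forall z : 'rV[R]_n * R, t0 < z.2 ->
    {for z, continuous (fun y : 'rV[R]_n * R => l y.1 y.2)} ;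
  ls_dx_cont : forall i (z : 'rV[R]_n * R), t0 < z.2 ->
    {for z, continuous (fun y : 'rV[R]_n * R => p i y.1 y.2)} ;
  ls_dxx_cont : forall i (z : 'rV[R]_n * R), t0 < z.2 ->
    {for z, continuous (fun y : 'rV[R]_n * R => q i y.1 y.2)} ;
  ls_eq : forall x t, t0 < t ->
    tau x t = \sum_j (q j x t + p j x t ^+ 2) + a - b * expR (2 * l x t)
}.

Definition neighbour (R : realType) (n : nat) (s : R) (x : 'rV[R]_n)
    (k : 'I_n * bool) : 'rV[R]_n :=
  x + (if k.2 then s else - s) *: basis_vec k.1.

Lemma neighbourD (R : realType) (n : nat) (s : R) (x v : 'rV[R]_n) k :
  neighbour s (x + v) k = neighbour s x k + v.
Proof. by rewrite /neighbour addrAC. Qed.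

(** The neighbours translate rigidly with [x], so differentiating the energy twice along an axis
    only differentiates [l] twice at finitely many points; no third derivative appears. Minimality
    is used only along the coordinate lines and backwards in time, which are the three hypotheses of
    [discrete_bochner]. *)
Lemma discrete_min (R : realType) (n : nat) (a b t0 al be ga s f1 rho : R)
    (l tau : 'rV[R]_n -> R -> R) (p q : 'I_n -> 'rV[R]_n -> R -> R)
    (x : 'rV[R]_n) (t : R) (Z Z1 : 'I_n -> R -> R) (z2 : 'I_n -> R) (g : R -> R) :
  log_solution a b t0 l tau p q -> t0 < t -> s != 0 -> 0 < rho ->
  (forall j (r : R), `|r| < rho -> is_derive r 1 (Z j) (Z1 j r)) ->
  (forall j, is_derive (0 : R) 1 (Z1 j) (z2 j)) ->
  is_derive t 1 g f1 ->
  let H y t' := energy al be ga s (l y t') (fun k => l (neighbour s y k) t') in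
  (forall j (r : R), `|r| < rho ->
     H x t + Z j 0 <= H (x + r *: basis_vec j) t + Z j r) ->
  (forall t', t - rho < t' < t -> H x t + g t <= H x t' + g t') ->
  let w := expR (2 * l x t) in
  let d k := (l (neighbour s x k) t - l x t) / s in
  \sum_k (al - be + s * be * d k) *
      (\sum_j ((p j (neighbour s x k) t - p j x t) / s) ^+ 2)
    - b * \sum_k (al / s + be * d k) *
        ((expR (2 * l (neighbour s x k) t) - w) / s)
    + ga * (- 6 * w * \sum_j p j x t ^+ 2 + 2 * a * w - 2 * b * w ^+ 2)
    - \sum_j z2 j - 2 * \sum_j p j x t * Z1 j 0 + f1 <= 0.
Proof.
move=> LS tt s0 rho0 ZD Z1D gD H Hx Ht /=.
set w := expR (2 * l x t).
have lD y j (r : R) := ls_dx LS j tt y r.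
have pD y j (r : R) := ls_dxx LS j tt y r.
have HxD j (r : R) : `|r| < rho ->
    is_derive r 1 (fun r => H (x + r *: basis_vec j) t + Z j r)
     (\sum_k (al / s + be * ((l (neighbour s x k + r *: basis_vec j) t
        - l (x + r *: basis_vec j) t) / s)) *
         ((p j (neighbour s x k + r *: basis_vec j) t
          - p j (x + r *: basis_vec j) t) / s)
      + ga * (2 * expR (2 * l (x + r *: basis_vec j) t)
                * p j (x + r *: basis_vec j) t) + Z1 j r).
  move=> rr; apply: is_deriveD; last exact: ZD.
  rewrite (_ : (fun r => _) = fun r => energy al be ga s (l (x + r *: basis_vec j) t)
     (fun k => l (neighbour s x k + r *: basis_vec j) t)).
    exact: (energy_is_derive al be ga s (lD x j r)
      (fun k => lD (neighbour s x k) j r)).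
  apply/funext => y; rewrite /H; congr energy.
  by apply/funext => k; rewrite neighbourD.
have z0 (y : 'rV[R]_n) j : y + 0 *: basis_vec j = y by rewrite scale0r addr0.
apply: (@discrete_bochner R n _ a b al be ga s w (tau x t) f1
  (fun k => (l (neighbour s x k) t - l x t) / s)
  (fun k => expR (2 * l (neighbour s x k) t)) (fun k => tau (neighbour s x k) t)
  (fun k j => (p j (neighbour s x k) t - p j x t) / s)
  (fun k j => q j (neighbour s x k) t) (fun j => p j x t) (fun j => q j x t)
  (fun j => Z1 j 0) z2) => //.
- exact: (ls_eq LS x tt).
- move=> k; rewrite (ls_eq LS) //; congr (_ + _ - _); apply: eq_bigr => j _.
  by congr (_ + _ ^+ 2); field.
- have HD := energy_is_derive al be ga s (ls_dt LS x tt)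
    (fun k => ls_dt LS (neighbour s x k) tt).
  exact: (left_min_derive_le0 rho0 (is_deriveD HD gD) Ht).
- move=> j; apply: (@min_derive0 R (fun r => H (x + r *: basis_vec j) t + Z j r) _ rho) => //.
    have := HxD j 0; rewrite normr0 => /(_ rho0); rewrite !z0.
    by under eq_bigr do rewrite z0.
  by move=> r rr; rewrite z0; exact: Hx.
- move=> j; apply: (min_derive2_ge0 rho0 (HxD j)); last first.
    by move=> r rr; rewrite z0; exact: Hx.
  apply: is_deriveD => //.
  have := energy_is_derive2 al be ga s (lD x j 0)
    (fun k => lD (neighbour s x k) j 0) (pD x j 0)
    (fun k => pD (neighbour s x k) j 0).
  rewrite !z0; under eq_bigr do rewrite !z0.
  exact.
Qed.

(** * Limits of the discretised terms *)

Lemma cvg_finsum (R : realType) (T : Type) (F : set_system T) (FF : Filter F)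
    (K : finType) (f : K -> T -> R) (c : K -> R) :
  (forall k, f k x @[x --> F] --> c k) ->
  \sum_k f k x @[x --> F] --> \sum_k c k.
Proof.
by move=> fc; apply: cvg_big => //; exact: add_continuous.
Qed.

Lemma cvg_sqr (R : realType) (T : Type) (F : set_system T) (FF : Filter F)
    (f : T -> R) (c : R) :
  f @ F --> c -> f x ^+ 2 @[x --> F] --> c ^+ 2.
Proof. by move=> fc; rewrite expr2; exact: (cvgM fc fc). Qed.

Lemma sum_pair_bool (R : nmodType) (I : finType) (F : I * bool -> R) :
  \sum_k F k = \sum_i (F (i, true) + F (i, false)).
Proof.
rewrite (eq_bigr (fun k => F (k.1, k.2))); last by case.
rewrite -(pair_bigA _ (fun i c => F (i, c))) /=; apply: eq_bigr => i _.
by rewrite big_bool.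
Qed.

Section Limits.
Context (R : realType) (n : nat) (a b t0 : R).
Context (l tau : 'rV[R]_n -> R -> R) (p q : 'I_n -> 'rV[R]_n -> R -> R).
Context (LS : log_solution a b t0 l tau p q).
Context (z : 'rV[R]_n * R) (tz : t0 < z.2).

Let w (x : 'rV[R]_n) (t : R) := expR (2 * l x t).
Let dl (zs : ('rV[R]_n * R) * R) (k : 'I_n * bool) :=
  (l (neighbour zs.2 zs.1.1 k) zs.1.2 - l zs.1.1 zs.1.2) / zs.2.
Let dp (zs : ('rV[R]_n * R) * R) (k : 'I_n * bool) (j : 'I_n) :=
  (p j (neighbour zs.2 zs.1.1 k) zs.1.2 - p j zs.1.1 zs.1.2) / zs.2.
Let dw (zs : ('rV[R]_n * R) * R) (k : 'I_n * bool) :=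
  (w (neighbour zs.2 zs.1.1 k) zs.1.2 - w zs.1.1 zs.1.2) / zs.2.

Let sg (k : 'I_n * bool) : R := if k.2 then 1 else - 1.

Lemma difference_cvg (u : 'rV[R]_n -> R -> R) (u1 : 'I_n -> 'rV[R]_n -> R -> R)
    (k : 'I_n * bool) :
  (forall i t, t0 < t -> line_derivative (u^~ t) (u1 i ^~ t) (basis_vec i)) ->
  (forall i, {for z, continuous (fun y => u1 i y.1 y.2)}) ->
  (u (neighbour zs.2 zs.1.1 k) zs.1.2 - u zs.1.1 zs.1.2) / zs.2
     @[zs --> near0p z] --> sg k * u1 k.1 z.1 z.2.
Proof.
move=> uD u1c; case: k => i [] /=; rewrite /neighbour /sg /=.
  by rewrite mul1r; apply: (forward_difference_cvg tz (uD i)).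
rewrite mulN1r; under eq_fun do rewrite scaleNr.
exact: (backward_difference_cvg tz (uD i)).
Qed.

Lemma dl_cvg k : dl zs k @[zs --> near0p z] --> sg k * p k.1 z.1 z.2.
Proof.
apply: difference_cvg => i; first by move=> t; exact: (ls_dx LS).
exact: (ls_dx_cont LS).
Qed.

Lemma dp_cvg i c : dp zs (i, c) i @[zs --> near0p z] --> sg (i, c) * q i z.1 z.2.
Proof.
have pD t : t0 < t -> line_derivative (p i ^~ t) (q i ^~ t) (basis_vec i).
  exact: (ls_dxx LS).
have qc : {for z, continuous (fun y => q i y.1 y.2)} := ls_dxx_cont LS tz.
case: c; rewrite /dp /neighbour /sg /=.
  by rewrite mul1r; apply: (forward_difference_cvg tz pD).
rewrite mulN1r; under eq_fun do rewrite scaleNr.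
exact: (backward_difference_cvg tz pD).
Qed.

Let w1 i (x : 'rV[R]_n) (t : R) := 2 * w x t * p i x t.
Let w2 i (x : 'rV[R]_n) (t : R) := 2 * w x t * q i x t + 4 * w x t * p i x t ^+ 2.

Lemma w_line i t : t0 < t -> line_derivative (w^~ t) (w1 i ^~ t) (basis_vec i).
Proof. by move=> tt x r; apply: is_derive_expR2; exact: (ls_dx LS i tt x r). Qed.

Lemma w1_line i t : t0 < t ->
  line_derivative (w1 i ^~ t) (w2 i ^~ t) (basis_vec i).
Proof.
move=> tt x r; have h1 := w_line i tt x r; have h2 := ls_dxx LS i tt x r.
rewrite /w1; apply: is_derive_eq; rewrite /GRing.scale /= /w2 /w1; ring.
Qed.

Lemma w_cont : {for z, continuous (fun y => w y.1 y.2)}.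
Proof.
have h : 2 * l y.1 y.2 @[y --> z] --> 2 * l z.1 z.2.
  by apply: cvgM; [exact: cvg_cst | exact: (ls_cont LS tz)].
exact: (cvg_comp _ expR h (@continuous_expR R _)).
Qed.

Lemma w1_cont i : {for z, continuous (fun y => w1 i y.1 y.2)}.
Proof.
apply: cvgM; last exact: (ls_dx_cont LS).
by apply: cvgM; [exact: cvg_cst | exact: w_cont].
Qed.

Lemma w2_cont i : {for z, continuous (fun y => w2 i y.1 y.2)}.
Proof.
apply: cvgD; apply: cvgM.
- by apply: cvgM; [exact: cvg_cst | exact: w_cont].
- exact: (ls_dxx_cont LS).
- by apply: cvgM; [exact: cvg_cst | exact: w_cont].
- by apply: cvg_sqr; exact: (ls_dx_cont LS).
Qed.

Lemma dw_cvg k : dw zs k @[zs --> near0p z] --> sg k * w1 k.1 z.1 z.2.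
Proof.
by apply: difference_cvg => i; [move=> t; exact: w_line | exact: w1_cont].
Qed.

Let second (u : 'rV[R]_n -> R -> R) (zs : ('rV[R]_n * R) * R) (i : 'I_n) :
  (u (neighbour zs.2 zs.1.1 (i, true)) zs.1.2 - u zs.1.1 zs.1.2) / zs.2 / zs.2
  + (u (neighbour zs.2 zs.1.1 (i, false)) zs.1.2 - u zs.1.1 zs.1.2) / zs.2 / zs.2
  = (u (zs.1.1 + zs.2 *: basis_vec i) zs.1.2
     + u (zs.1.1 - zs.2 *: basis_vec i) zs.1.2 - 2 * u zs.1.1 zs.1.2) / zs.2 ^+ 2.
Proof. by rewrite /neighbour /= scaleNr expr2 invfM; ring. Qed.

Lemma ddl_cvg i : dl zs (i, true) / zs.2 + dl zs (i, false) / zs.2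
  @[zs --> near0p z] --> q i z.1 z.2.
Proof.
rewrite /dl; under eq_fun do rewrite second.
apply: (second_difference_cvg tz) (ls_dxx_cont LS (i := i) tz) => t.
  exact: (ls_dx LS).
exact: (ls_dxx LS).
Qed.

Lemma ddw_cvg i : dw zs (i, true) / zs.2 + dw zs (i, false) / zs.2
  @[zs --> near0p z] --> w2 i z.1 z.2.
Proof.
rewrite /dw; under eq_fun do rewrite second.
apply: (second_difference_cvg tz) (@w2_cont i) => t.
  exact: w_line.
exact: w1_line.
Qed.

Lemma energy_cvg al be ga :
  energy al be ga zs.2 (l zs.1.1 zs.1.2) (fun k => l (neighbour zs.2 zs.1.1 k) zs.1.2)
  @[zs --> near0p z] -->
  al * \sum_i q i z.1 z.2 + be * \sum_i p i z.1 z.2 ^+ 2 + ga * w z.1 z.2.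
Proof.
rewrite /energy; apply: cvgD; last first.
  by apply: cvgM; [exact: cvg_cst | exact: (near0p_fst w_cont)].
rewrite !mulr_sumr -big_split /=.
rewrite (_ : (fun zs => _) = fun zs : ('rV[R]_n * R) * R => \sum_i
    (al * (dl zs (i, true) / zs.2 + dl zs (i, false) / zs.2)
     + be / 2 * (dl zs (i, true) ^+ 2 + dl zs (i, false) ^+ 2))); last first.
  apply/funext => zs; rewrite sum_pair_bool; apply: eq_bigr => i _.
  by rewrite -/(dl zs (i, true)) -/(dl zs (i, false)); ring.
apply: cvg_finsum => i; apply: cvgD.
  by apply: cvgM; [exact: cvg_cst | exact: ddl_cvg].
rewrite [X in _ --> X](_ : _ = be / 2 * ((sg (i, true) * p i z.1 z.2) ^+ 2
   + (sg (i, false) * p i z.1 z.2) ^+ 2)); last by rewrite /sg /=; field.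
apply: cvgM; first exact: cvg_cst.
by apply: cvgD; apply: cvg_sqr; [exact: (@dl_cvg (i, true)) | exact: (@dl_cvg (i, false))].
Qed.

Lemma weight_cvg al be k :
  al - be + zs.2 * be * dl zs k @[zs --> near0p z] --> al - be.
Proof.
rewrite [X in _ --> X](_ : _ = al - be + 0 * be * (sg k * p k.1 z.1 z.2)); last by ring.
apply: cvgD; first exact: cvg_cst.
apply: cvgM; last exact: dl_cvg.
by apply: cvgM; [exact: near0p_snd | exact: cvg_cst].
Qed.

(** Only the pure quotients [dp zs k k.1] are kept. The factor 2 arises because each direction is
    seen by two neighbours. *)
Lemma hessian_cvg al be :
  \sum_k (al - be + zs.2 * be * dl zs k) * dp zs k k.1 ^+ 2
  @[zs --> near0p z] --> 2 * (al - be) * \sum_i q i z.1 z.2 ^+ 2.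
Proof.
rewrite [X in _ --> X](_ : _ = \sum_(k : 'I_n * bool) (al - be) * (sg k * q k.1 z.1 z.2) ^+ 2).
  apply: cvg_finsum => -[i c]; apply: cvgM; first exact: weight_cvg.
  by apply: cvg_sqr; exact: dp_cvg.
rewrite sum_pair_bool mulr_sumr; apply: eq_bigr => i _; rewrite /sg /=; ring.
Qed.

(** The limit is [al Delta w + 2 be grad l . grad w], expanded for [w = e^(2l)]: the weights
    [al / s] build second differences, the weights [be * dl] products of first ones. *)
Lemma reaction_cvg al be :
  \sum_k (al / zs.2 + be * dl zs k) * dw zs k @[zs --> near0p z] -->
  al * w z.1 z.2 * (2 * \sum_i q i z.1 z.2 + 4 * \sum_i p i z.1 z.2 ^+ 2)
  + 4 * be * w z.1 z.2 * \sum_i p i z.1 z.2 ^+ 2.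
Proof.
rewrite [X in _ --> X](_ : _ = \sum_i (al * w2 i z.1 z.2
    + be * ((sg (i, true) * p i z.1 z.2) * (sg (i, true) * w1 i z.1 z.2)
            + (sg (i, false) * p i z.1 z.2) * (sg (i, false) * w1 i z.1 z.2)))).
  rewrite (_ : (fun zs => _) = fun zs : ('rV[R]_n * R) * R => \sum_i
    (al * (dw zs (i, true) / zs.2 + dw zs (i, false) / zs.2)
     + be * (dl zs (i, true) * dw zs (i, true)
             + dl zs (i, false) * dw zs (i, false)))); last first.
    apply/funext => zs; rewrite sum_pair_bool; apply: eq_bigr => i _; ring.
  apply: cvg_finsum => i; apply: cvgD; apply: cvgM; try exact: cvg_cst.
    exact: ddw_cvg.
  apply: cvgD; apply: cvgM.
  - exact: (@dl_cvg (i, true)).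
  - exact: (@dw_cvg (i, true)).
  - exact: (@dl_cvg (i, false)).
  - exact: (@dw_cvg (i, false)).
rewrite !mulr_sumr -!big_split /= mulr_sumr -big_split /=.
by apply: eq_bigr => i _; rewrite /sg /w2 /w1 /=; ring.
Qed.

End Limits.

(** * The barrier *)

Section Barrier.
Context (R : realType) (A r : R) (A0 : 0 < A) (r0 : 0 < r).

(** Homogeneous of degree -2 in [(x, r)], the scaling of [z'' = z^2]: the constant [A] can therefore
    be independent of [r], and the value at the centre, [A / r ^+ 2], vanishes as [r] grows. *)
Definition barrier (x : R) : R := A * r ^+ 2 * ((r ^+ 2 - x ^+ 2) ^+ 2)^-1.
Definition barrier1 (x : R) : R := 4 * A * r ^+ 2 * x * ((r ^+ 2 - x ^+ 2) ^+ 3)^-1.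
Definition barrier2 (x : R) : R :=
  4 * A * r ^+ 2 * ((r ^+ 2 - x ^+ 2) ^+ 3)^-1
  + 24 * A * r ^+ 2 * x ^+ 2 * ((r ^+ 2 - x ^+ 2) ^+ 4)^-1.

Lemma barrier_gap (x : R) : `|x| < r -> 0 < r ^+ 2 - x ^+ 2.
Proof. by move=> xr; rewrite subr_gt0 -(real_normK (num_real x)) ltr_pXn2r // nnegrE ltW. Qed.

Lemma barrier_gt0 (x : R) : `|x| < r -> 0 < barrier x.
Proof.
move=> /barrier_gap h.
by rewrite /barrier mulr_gt0 ?invr_gt0 ?exprn_gt0 // mulr_gt0 // exprn_gt0.
Qed.

Let gap_derive (x : R) (m : nat) : `|x| < r ->
  is_derive x 1 (fun y : R => ((r ^+ 2 - y ^+ 2) ^+ m.+1)^-1)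
    (2 * m.+1%:R * x * ((r ^+ 2 - x ^+ 2) ^+ m.+2)^-1).
Proof.
move=> /barrier_gap h.
have h1 : is_derive x 1 (fun y : R => (r ^+ 2 - y ^+ 2) ^+ m.+1)
    (- (2 * m.+1%:R * x * (r ^+ 2 - x ^+ 2) ^+ m)).
  have h0 : is_derive x 1 (fun y : R => r ^+ 2 - y ^+ 2) (- (2 * x)).
    by apply: is_derive_eq; rewrite /GRing.scale /=; ring.
  have h1 := is_deriveX m.+1 h0; rewrite exprfctE in h1.
  by apply: (is_derive_eq h1); rewrite /GRing.scale /=; ring.
have n0 : (r ^+ 2 - x ^+ 2) ^+ m.+1 != 0 by rewrite expf_neq0 // gt_eqF.
have h2 := @is_deriveV R (fun y : R => (r ^+ 2 - y ^+ 2) ^+ m.+1) x _ 1 n0 h1.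
apply: (is_derive_eq h2).
rewrite /GRing.scale /= !(exprS (r ^+ 2 - x ^+ 2)); field.
by rewrite expf_neq0 gt_eqF.
Qed.

Lemma barrier_derive (x : R) : `|x| < r -> is_derive x 1 barrier (barrier1 x).
Proof.
move=> xr; have h := gap_derive 1 xr.
rewrite /barrier; apply: is_derive_eq; rewrite /GRing.scale /= /barrier1; ring.
Qed.

Lemma barrier1_derive (x : R) : `|x| < r -> is_derive x 1 barrier1 (barrier2 x).
Proof.
move=> xr; have h := gap_derive 2 xr.
rewrite /barrier1; apply: is_derive_eq; rewrite /GRing.scale /= /barrier2; ring.
Qed.

(** All terms share the factor [A * r ^+ 2 / (r ^+ 2 - x ^+ 2) ^+ 4]. Bounding [x ^+ 2] and the gap
    by [r ^+ 2] leaves 4 + 24 from [barrier2] and [16 / k] from the squared gradient. *)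
Lemma barrier_supersolution (k c2 x : R) : 0 < k -> 0 < c2 ->
  c2 * A = 28 + 16 / k -> `|x| < r ->
  barrier2 x + barrier1 x ^+ 2 / (k * barrier x) <= c2 * barrier x ^+ 2.
Proof.
move=> k0 c20 hA xr; have h := barrier_gap xr.
have hle : r ^+ 2 - x ^+ 2 <= r ^+ 2 by rewrite lerBlDr lerDl sqr_ge0.
have hx : x ^+ 2 <= r ^+ 2 by rewrite -subr_ge0 ltW.
have rr : 0 < r ^+ 2 by rewrite exprn_gt0.
rewrite /barrier2 /barrier1 /barrier.
set g := r ^+ 2 - x ^+ 2 in h hle *.
have -> : (4 * A * r ^+ 2 * x * (g ^+ 3)^-1) ^+ 2 / (k * (A * r ^+ 2 * (g ^+ 2)^-1))
   = A * r ^+ 2 * (16 / k * x ^+ 2) * (g ^+ 4)^-1.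
  by field; rewrite !gt_eqF.
have -> : c2 * (A * r ^+ 2 * (g ^+ 2)^-1) ^+ 2
   = A * r ^+ 2 * ((28 + 16 / k) * r ^+ 2) * (g ^+ 4)^-1.
  by rewrite -hA; field; rewrite !gt_eqF.
have -> : 4 * A * r ^+ 2 * (g ^+ 3)^-1 = A * r ^+ 2 * (4 * g) * (g ^+ 4)^-1.
  by field; rewrite !gt_eqF.
have -> : 24 * A * r ^+ 2 * x ^+ 2 = A * r ^+ 2 * (24 * x ^+ 2) by ring.
rewrite -!mulrDl -!mulrDr ler_pM2r ?invr_gt0 ?exprn_gt0 // ler_pM2l ?mulr_gt0 //.
have : 16 / k * x ^+ 2 <= 16 / k * r ^+ 2 by rewrite ler_pM2l // divr_gt0.
by lra.
Qed.

Lemma barrier_continuous (x : R) : `|x| < r -> {for x, continuous barrier}.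
Proof.
move=> xr; apply: differentiable_continuous; apply/derivable1_diffP.
by have [] := barrier_derive xr.
Qed.

Lemma barrier1_continuous (x : R) : `|x| < r -> {for x, continuous barrier1}.
Proof.
move=> xr; apply: differentiable_continuous; apply/derivable1_diffP.
by have [] := barrier1_derive xr.
Qed.

Lemma barrier2_continuous (x : R) : `|x| < r -> {for x, continuous barrier2}.
Proof.
move=> xr; apply: differentiable_continuous; apply/derivable1_diffP.
have h2 := gap_derive 2 xr; have h3 := gap_derive 3 xr.
by rewrite /barrier2; apply: ex_derive.
Qed.

End Barrier.

(** The value at [r] itself is useless, being 0 by the convention for the inverse of 0; the boundary
    is therefore placed at some [r' < r]. *)
Lemma barrier_blowup (R : realType) (A r C : R) : 0 < A -> 0 < r ->
  exists2 r', 0 < r' < r & C <= barrier A r r'.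
Proof.
move=> A0 r0; pose C' := Num.max C 1.
have C'0 : 0 < C' by rewrite lt_max ltr01 orbT.
(* At [r - th] the gap is at most [2 * r * th], so it suffices that [4 * C' * th ^+ 2 <= A]; the
   bound [th <= 1] makes this linear in [th]. *)
pose th := Num.min (r / 2) (Num.min 1 (A / (4 * C'))).
have th0 : 0 < th by rewrite !lt_min ltr01 !divr_gt0 // mulr_gt0.
have [th1 th2 th3] : [/\ th <= r / 2, th <= 1 & th <= A / (4 * C')].
  by split; rewrite /th !ge_min lexx ?orbT.
have rr : 0 < r - th < r by apply/andP; split; lra.
exists (r - th) => //; have [h1 h2] := andP rr.
apply: (@le_trans _ _ C'); first by rewrite le_max lexx.
have gap : 0 < r ^+ 2 - (r - th) ^+ 2.
  by apply: barrier_gap => //; rewrite gtr0_norm.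
rewrite /barrier ler_pdivlMr ?exprn_gt0 //.
move: th3; rewrite ler_pdivlMr ?mulr_gt0 // => th3.
have g2 : r ^+ 2 - (r - th) ^+ 2 <= 2 * r * th by nra.
have : (r ^+ 2 - (r - th) ^+ 2) ^+ 2 <= (2 * r * th) ^+ 2.
  by rewrite ler_pXn2r // ?nnegrE ltW // !mulr_gt0.
have : th ^+ 2 <= th by rewrite expr2; nra.
move=> k1 k2.
have : C' * (r ^+ 2 - (r - th) ^+ 2) ^+ 2 <= C' * (2 * r * th) ^+ 2.
  by rewrite ler_pM2l.
move=> /le_trans; apply.
have -> : C' * (2 * r * th) ^+ 2 = (4 * C' * th ^+ 2) * r ^+ 2 by ring.
rewrite ler_pM2r ?exprn_gt0 //.
have : 4 * C' * th ^+ 2 <= 4 * C' * th by rewrite ler_pM2l // mulr_gt0.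
by lra.
Qed.

(** * The maximum principle *)

(** The last clause makes [phi] a supersolution of the Riccati inequality with the
    quadratic margin [c2 * z ^+ 2].  Only the germ of [phi] to the left of [t] is
    constrained, so that [psi] need not be differentiated at its switching time. *)
Record weight (R : realType) (c ga a b c2 : R) (phi : R -> R) : Prop := {
  weight_ge0 : forall t : R, 0 < t -> 0 <= phi t ;
  weight_cont : forall t : R, 0 < t -> {for t, continuous phi} ;
  weight_blowup : forall C t : R, 0 < t -> exists2 e, 0 < e < t & C <= phi e ;
  weight_ode : forall t : R, 0 < t -> exists g : R -> R, exists d rho : R,
    [/\ 0 < rho, is_derive t 1 g d,
        forall r, t - rho < r <= t -> 0 < r -> phi r = g r &
        forall w z, 0 <= w -> 0 <= z ->
          c2 * z ^+ 2 <= c * (phi t + z + ga * w) ^+ 2 + 2 * b * w * (phi t + z)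
                         + 2 * a * ga * w + d]
}.

(** The left side of [discrete_bochner] with the derivative of [phi] replaced by its lower bound
    from [weight_ode]. No derivative of [phi] is left, so the expression depends continuously on the
    point, also across a switching time. *)
Definition harnack_residual (R : realType) (a b ga c c2 hes rea z1 z2 w y f N : R) : R :=
  hes - b * rea + ga * (- 6 * w * y + 2 * a * w - 2 * b * w ^+ 2)
  - z2 - 2 * z1
  + (c2 * N ^+ 2 - (c * (f + N + ga * w) ^+ 2 + 2 * b * w * (f + N)
                    + 2 * a * ga * w)).

Lemma residual_cvg (R : realType) (T : Type) (F : set_system T) (FF : Filter F)
    (a b ga c c2 h' r' z1' z2' w' y' f' N' : R) (h r z1 z2 w y f N : T -> R) :
  h @ F --> h' -> r @ F --> r' -> z1 @ F --> z1' -> z2 @ F --> z2' ->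
  w @ F --> w' -> y @ F --> y' -> f @ F --> f' -> N @ F --> N' ->
  harnack_residual a b ga c c2 (h t) (r t) (z1 t) (z2 t) (w t) (y t) (f t) (N t)
    @[t --> F] --> harnack_residual a b ga c c2 h' r' z1' z2' w' y' f' N'.
Proof.
move=> ch cr c1 c2' cw cy cf cN.
have k x : (fun=> x) @ F --> (x : R) by exact: cvg_cst.
have cw2 := cvg_sqr FF cw; have cN2 := cvg_sqr FF cN.
exact: (cvgD
  (cvgB (cvgB (cvgD (cvgB ch (cvgM (k b) cr))
      (cvgM (k ga) (cvgB (cvgD (cvgM (cvgM (k (- 6)) cw) cy)
        (cvgM (k (2 * a)) cw)) (cvgM (k (2 * b)) cw2)))) c2') (cvgM (k 2) c1))
  (cvgB (cvgM (k c2) cN2)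
    (cvgD (cvgD (cvgM (k c) (cvg_sqr FF (cvgD (cvgD cf cN) (cvgM (k ga) cw))))
      (cvgM (cvgM (k (2 * b)) cw) (cvgD cf cN))) (cvgM (k (2 * a * ga)) cw)))).
Qed.

Lemma residual_le (R : realType) (a b ga c c2 h h' r z1 z2 w y f N : R) :
  h <= h' -> harnack_residual a b ga c c2 h r z1 z2 w y f N
             <= harnack_residual a b ga c c2 h' r z1 z2 w y f N.
Proof. by move=> hh; rewrite /harnack_residual !lerD2r. Qed.

Section Core.
Context (R : realType) (n : nat) (a b t0 al be ga c c2 : R).
Context (l tau : 'rV[R]_n -> R -> R) (p q : 'I_n -> 'rV[R]_n -> R -> R).
Context (LS : log_solution a b t0 l tau p q) (t00 : t0 < 0).
Context (phi : R -> R) (W : weight c ga a b c2 phi).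
Context (b0 : 0 < b) (be0 : 0 < be) (beal : be < al) (c0 : 0 < c) (c20 : 0 < c2).
Context (hc : c * al ^+ 2 * n%:R = 2 * (al - be)).
Context (hk : 0 <= 2 * c * be * ga - 4 * b * al - 2 * b * be - 6 * ga).

Let dH (s : R) (x : 'rV[R]_n) (t : R) :=
  energy al be ga s (l x t) (fun k => l (neighbour s x k) t).

Let Hlim (x : 'rV[R]_n) (t : R) :=
  al * \sum_i q i x t + be * \sum_i p i x t ^+ 2 + ga * expR (2 * l x t).

Let hessian s x t := \sum_k (al - be + s * be * ((l (neighbour s x k) t - l x t) / s))
   * (\sum_j ((p j (neighbour s x k) t - p j x t) / s) ^+ 2).

Let reaction s x t := \sum_k (al / s + be * ((l (neighbour s x k) t - l x t) / s))
   * ((expR (2 * l (neighbour s x k) t) - expR (2 * l x t)) / s).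

Let residual := harnack_residual a b ga c c2.

Context (x0 : 'rV[R]_n) (A r del : R) (r0 : 0 < r) (del0 : 0 < del).
Context (hA : c2 * A = 28 + 16 / (2 * c * be)).

Let A0 : 0 < A.
Proof.
have : 0 < c2 * A by rewrite hA addr_gt0 // divr_gt0 // !mulr_gt0.
by rewrite pmulr_rgt0.
Qed.

Let bar (x : 'rV[R]_n) := \sum_j barrier A r (x 0 j - x0 0 j).
Let z1 (x : 'rV[R]_n) (t : R) := \sum_j p j x t * barrier1 A r (x 0 j - x0 0 j).
Let z2 (x : 'rV[R]_n) := \sum_j barrier2 A r (x 0 j - x0 0 j).

(** The properties that a minimum point of energy plus [phi] plus barrier inherits when its value
    there is below [- del]. *)
Let bad (s : R) (z : 'rV[R]_n * R) :=
  dH s z.1 z.2 + phi z.2 <= - (bar z.1 + del) /\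
  residual (hessian s z.1 z.2) (reaction s z.1 z.2) (z1 z.1 z.2) (z2 z.1)
    (expR (2 * l z.1 z.2)) (\sum_j p j z.1 z.2 ^+ 2) (phi z.2)
    (- (dH s z.1 z.2 + phi z.2)) <= 0.

Let coord_cvg (z : 'rV[R]_n * R) (g : R -> R) j :
  {for z.1 0 j - x0 0 j, continuous g} ->
  (fun y : 'rV[R]_n * R => g (y.1 0 j - x0 0 j)) @ z --> g (z.1 0 j - x0 0 j).
Proof.
move=> gc.
have h : (fun y : 'rV[R]_n * R => y.1 0 j - x0 0 j) @ z --> z.1 0 j - x0 0 j.
  apply: cvgD; last exact: cvg_cst.
  have h0 : y.1 @[y --> z] --> z.1 by exact: cvg_fst.
  exact: (cvg_comp _ (fun x : 'rV[R]_n => x 0 j) h0 (@coord_continuous R 1 n 0 j z.1)).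
exact: (cvg_comp _ g h gc).
Qed.

(** If the limiting [h] lies above [- (bar + del)], the first clause of [bad] fails nearby.
    Otherwise [pointwise_positive] makes the limiting residual positive, and the second clause fails
    nearby. *)
Let not_bad (z : 'rV[R]_n * R) : 0 < z.2 ->
  (forall j, `|z.1 0 j - x0 0 j| < r) ->
  \forall z' \near z & s \near 0^'+, ~ bad s z'.
Proof.
move=> z20 zr; suff : \forall zs \near near0p z, ~ bad zs.2 zs.1 by [].
have FF : Filter (near0p z) by apply: filter_prod_filter.
have tz : t0 < z.2 by apply: lt_trans z20.
have fphi : phi zs.1.2 @[zs --> near0p z] --> phi z.2.
  apply: (@near0p_fst R _ z (fun y => phi y.2)).
  have h0 : y.2 @[y --> z] --> z.2 by exact: cvg_snd.
  exact: (cvg_comp _ phi h0 (weight_cont W z20)).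
have fbar : bar zs.1.1 @[zs --> near0p z] --> bar z.1.
  apply: (@near0p_fst R _ z (fun y => bar y.1)); apply: cvg_finsum => j.
  by apply: coord_cvg; apply: barrier_continuous.
have fz2 : z2 zs.1.1 @[zs --> near0p z] --> z2 z.1.
  apply: (@near0p_fst R _ z (fun y => z2 y.1)); apply: cvg_finsum => j.
  by apply: coord_cvg; apply: barrier2_continuous.
have fz1 : z1 zs.1.1 zs.1.2 @[zs --> near0p z] --> z1 z.1 z.2.
  apply: (@near0p_fst R _ z (fun y => z1 y.1 y.2)); apply: cvg_finsum => j.
  apply: cvgM; first exact: (ls_dx_cont LS (i := j) tz).
  by apply: coord_cvg; apply: barrier1_continuous.
have fw : expR (2 * l zs.1.1 zs.1.2) @[zs --> near0p z] --> expR (2 * l z.1 z.2).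
  exact: (near0p_fst (w_cont LS tz)).
have fy : \sum_j p j zs.1.1 zs.1.2 ^+ 2 @[zs --> near0p z] -->
    \sum_j p j z.1 z.2 ^+ 2.
  apply: (@near0p_fst R _ z (fun y => \sum_j p j y.1 y.2 ^+ 2)).
  apply: cvg_finsum => j; apply: cvg_sqr.
  exact: (ls_dx_cont LS (i := j) tz).
have fH : dH zs.2 zs.1.1 zs.1.2 @[zs --> near0p z] --> Hlim z.1 z.2.
  exact: (energy_cvg LS tz).
have fhes := @hessian_cvg _ _ _ _ _ _ _ _ _ LS z tz al be.
have frea := @reaction_cvg _ _ _ _ _ _ _ _ _ LS z tz al be.
have [hlt|hge] := ltP (- (bar z.1 + del)) (Hlim z.1 z.2 + phi z.2).
  have fG : dH zs.2 zs.1.1 zs.1.2 + phi zs.1.2 + (bar zs.1.1 + del)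
      @[zs --> near0p z] --> Hlim z.1 z.2 + phi z.2 + (bar z.1 + del).
    apply: cvgD; first exact: (cvgD fH fphi).
    by apply: cvgD; [exact: fbar | exact: cvg_cst].
  have G0 : 0 < Hlim z.1 z.2 + phi z.2 + (bar z.1 + del) by lra.
  have fG0 : \forall zs \near near0p z,
    0 < dH zs.2 zs.1.1 zs.1.2 + phi zs.1.2 + (bar zs.1.1 + del)
    by exact: (cvgr_gt _ fG _ G0).
  apply: (@filterS _ (near0p z) FF _ _ _ fG0) => zs h [+ _];
  move: (dH _ _ _ + _) (bar _) h => u v; lra.
have fR : residual
    (\sum_k (al - be + zs.2 * be
         * ((l (neighbour zs.2 zs.1.1 k) zs.1.2 - l zs.1.1 zs.1.2) / zs.2))
     * ((p k.1 (neighbour zs.2 zs.1.1 k) zs.1.2 - p k.1 zs.1.1 zs.1.2) / zs.2) ^+ 2)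
    (reaction zs.2 zs.1.1 zs.1.2) (z1 zs.1.1 zs.1.2) (z2 zs.1.1)
    (expR (2 * l zs.1.1 zs.1.2)) (\sum_j p j zs.1.1 zs.1.2 ^+ 2) (phi zs.1.2)
    (- (dH zs.2 zs.1.1 zs.1.2 + phi zs.1.2)) @[zs --> near0p z] -->
  residual (2 * (al - be) * \sum_i q i z.1 z.2 ^+ 2)
    (al * expR (2 * l z.1 z.2) * (2 * \sum_i q i z.1 z.2
        + 4 * \sum_i p i z.1 z.2 ^+ 2)
     + 4 * be * expR (2 * l z.1 z.2) * \sum_i p i z.1 z.2 ^+ 2)
    (z1 z.1 z.2) (z2 z.1) (expR (2 * l z.1 z.2)) (\sum_j p j z.1 z.2 ^+ 2)
    (phi z.2) (- (Hlim z.1 z.2 + phi z.2)).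
  exact: (residual_cvg FF fhes frea fz1 fz2 fw fy fphi
    (cvgN (cvgD fH fphi))).
have R0 : 0 < residual (2 * (al - be) * \sum_i q i z.1 z.2 ^+ 2)
    (al * expR (2 * l z.1 z.2) * (2 * \sum_i q i z.1 z.2
        + 4 * \sum_i p i z.1 z.2 ^+ 2)
     + 4 * be * expR (2 * l z.1 z.2) * \sum_i p i z.1 z.2 ^+ 2)
    (z1 z.1 z.2) (z2 z.1) (expR (2 * l z.1 z.2)) (\sum_j p j z.1 z.2 ^+ 2)
    (phi z.2) (- (Hlim z.1 z.2 + phi z.2)).
  apply: (@pointwise_positive R n a b al be ga c c2 (phi z.2) (expR (2 * l z.1 z.2))
    (- (Hlim z.1 z.2 + phi z.2)) del (fun j => p j z.1 z.2) (fun j => q j z.1 z.2)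
    (fun j => barrier A r (z.1 0 j - x0 0 j))
    (fun j => barrier1 A r (z.1 0 j - x0 0 j))
    (fun j => barrier2 A r (z.1 0 j - x0 0 j))) => //.
  - exact: (weight_ge0 W z20).
  - exact: expR_gt0.
  - by rewrite opprK.
  - by rewrite -/(bar z.1); lra.
  - by move=> j; apply: barrier_gt0.
  - by move=> j; apply: barrier_supersolution => //; rewrite !mulr_gt0.
(* The discrete weights tend to [al - be > 0]; once they are positive, the mixed squares in
   [hessian] may be discarded. *)
have fk : \forall zs \near near0p z, forall k : 'I_n * bool,
   0 < al - be + zs.2 * be
        * ((l (neighbour zs.2 zs.1.1 k) zs.1.2 - l zs.1.1 zs.1.2) / zs.2).
  apply: filter_forall => k; apply: (@cvgr_gt _ _ _ FF _ _ _ 0).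
    exact: (@weight_cvg _ _ _ _ _ _ _ _ _ LS z tz al be k).
  by rewrite subr_gt0.
have fR0 : \forall zs \near near0p z, 0 < residual
    (\sum_k (al - be + zs.2 * be
         * ((l (neighbour zs.2 zs.1.1 k) zs.1.2 - l zs.1.1 zs.1.2) / zs.2))
     * ((p k.1 (neighbour zs.2 zs.1.1 k) zs.1.2 - p k.1 zs.1.1 zs.1.2) / zs.2) ^+ 2)
    (reaction zs.2 zs.1.1 zs.1.2) (z1 zs.1.1 zs.1.2) (z2 zs.1.1)
    (expR (2 * l zs.1.1 zs.1.2)) (\sum_j p j zs.1.1 zs.1.2 ^+ 2) (phi zs.1.2)
    (- (dH zs.2 zs.1.1 zs.1.2 + phi zs.1.2)) by exact: (cvgr_gt _ fR _ R0).
apply: (@filterS2 _ (near0p z) FF _ _ _ _ fk fR0) => -[z' s] /= hw h [_].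
apply/negP; rewrite -ltNge; apply: (lt_le_trans h).
apply: residual_le; apply: ler_sum => k _; apply: ler_wpM2l; first exact: ltW.
by rewrite (bigD1 k.1) //= lerDl; apply: sumr_ge0 => j _; apply: sqr_ge0.
Qed.

Let energy_continuous (s : R) (z : 'rV[R]_n * R) : t0 < z.2 ->
  {for z, continuous (fun y : 'rV[R]_n * R => dH s y.1 y.2)}.
Proof.
move=> tz.
have lc : {for z, continuous (fun y : 'rV[R]_n * R => l y.1 y.2)} := ls_cont LS tz.
have lkc k : (fun y : 'rV[R]_n * R => l (neighbour s y.1 k) y.2) @ z -->
    l (neighbour s z.1 k) z.2.
  have h1 : (fun y : 'rV[R]_n * R => neighbour s y.1 k) @ z --> neighbour s z.1 k.
    by apply: cvgD; [exact: cvg_fst | exact: cvg_cst].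
  have h2 : (fun y : 'rV[R]_n * R => y.2) @ z --> z.2 by exact: cvg_snd.
  have h3 := ls_cont LS (z := (neighbour s z.1 k, z.2)) tz.
  exact: (cvg_comp _ (fun y : 'rV[R]_n * R => l y.1 y.2) (cvg_pair h1 h2) h3).
apply: cvgD; last first.
  by apply: cvgM; [exact: cvg_cst | exact: (w_cont LS tz)].
apply: cvg_finsum => k.
have hd : (fun y : 'rV[R]_n * R => (l (neighbour s y.1 k) y.2 - l y.1 y.2) / s) @ z
    --> (l (neighbour s z.1 k) z.2 - l z.1 z.2) / s.
  by apply: cvgM; [exact: (cvgB (lkc k) lc) | exact: cvg_cst].
apply: cvgD; apply: cvgM; try exact: cvg_cst; first exact: hd.
by apply: cvg_sqr; exact: hd.
Qed.

Let energy_near (z : 'rV[R]_n * R) : t0 < z.2 ->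
  (fun zs : ('rV[R]_n * R) * R => dH zs.2 zs.1.1 zs.1.2) @ near0p z --> Hlim z.1 z.2.
Proof. by move=> tz; exact: (energy_cvg LS tz). Qed.

Let energy_bounded (K : set ('rV[R]_n * R)) : compact K ->
  (forall z, K z -> t0 < z.2) ->
  exists C, \forall s \near 0^'+, forall z, K z -> - C <= dH s z.1 z.2.
Proof.
move=> /compact_near_coveringP Kc Kt.
have FF : Filter (filter_prod (0^'+ : set_system R) (+oo%R : set_system R)).
  exact: filter_prod_filter.
(* The bound is made a parameter tending to infinity along with [s] tending to 0, so that
   compactness yields a single constant valid for all small steps. *)
have [|[S B] [/= S0 B0] SB] := Kc _ _
    (fun (sC : R * R) z => - sC.2 <= dH sC.1 z.1 z.2) FF.
  move=> z Kz; have tz := Kt z Kz.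
  have FF' : Filter (near0p z) by apply: filter_prod_filter.
  have h1 : \forall zs \near near0p z, Hlim z.1 z.2 - 1 < dH zs.2 zs.1.1 zs.1.2.
    by apply: (@cvgr_gt _ _ _ FF' _ _ (energy_near tz)); rewrite ltrBlDr ltrDl.
  have [[U S] [/= Uz S0] US] := h1.
  exists (U, S `*` [set C | 1 - Hlim z.1 z.2 <= C]) => /=.
    split => //; exists (S, [set C | 1 - Hlim z.1 z.2 <= C]) => //=.
    by split => //; apply: nbhs_pinfty_ge; exact: num_real.
  move=> [z' [s C]] /= [Uz' [Ss hC]].
  by have := US (z', s) (conj Uz' Ss); rewrite /= => h2; lra.
have [C BC] := @filter_ex _ _ _ _ B0.
exists C; apply: filterS S0 => s Ss z Kz.
exact: (SB (s, C) (conj Ss BC) z Kz).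
Qed.

Let cylinder (r' e t1 : R) : set ('rV[R]_n * R) :=
  [set x | `|x0 - x| <= r'] `*` `[e, t1].

Let cylinder_compact (r' e t1 : R) : 0 < r' -> compact (cylinder r' e t1).
Proof.
move=> r'0; apply: compact_setX; last exact: segment_compact.
rewrite (_ : [set x | _] = closed_ball x0 r'); last by rewrite closed_ballE.
apply: bounded_closed_compact; last exact: closed_ball_closed.
rewrite closed_ballE //; exists (`|x0| + r'); split; first exact: num_real.
move=> M hM x /= hx; apply: ltW; apply: le_lt_trans hM.
rewrite -[x](subKr x0) (le_trans (ler_normB _ _)) // lerD2l //.
Qed.

Let coord_le (x : 'rV[R]_n) j : `|x 0 j - x0 0 j| <= `|x0 - x|.
Proof.
rewrite distrC [leRHS]/Num.norm /= mx_normrE.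
by apply/bigmax_geP; right => /=; exists (0, j) => //; rewrite !mxE.
Qed.

Let coord_eq (x : 'rV[R]_n) : 0 < `|x0 - x| ->
  exists j, `|x 0 j - x0 0 j| = `|x0 - x|.
Proof.
move=> h; have : mx_norm (x0 - x) != 0 by rewrite gt_eqF.
move=> /mx_norm_neq0[[i j]] /= E; exists j.
by rewrite [RHS]E !mxE distrC [i]ord1.
Qed.


Let bar_ge0 (x : 'rV[R]_n) : (forall j, `|x 0 j - x0 0 j| < r) -> 0 <= bar x.
Proof. by move=> xr; apply: sumr_ge0 => j _; apply: ltW; apply: barrier_gt0. Qed.

Let bar_move (x : 'rV[R]_n) j v :
  bar (x + v *: basis_vec j) - bar x
  = barrier A r (x 0 j + v - x0 0 j) - barrier A r (x 0 j - x0 0 j).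
Proof.
rewrite /bar -sumrB (bigD1 j) //= big1 ?addr0; last first.
  move=> i ij; rewrite !mxE eqxx /= (negbTE ij) mulr0 addr0 subrr //.
by rewrite !mxE !eqxx mulr1.
Qed.

Let norm_basis_vec (v : R) j : `|v *: basis_vec j : 'rV[R]_n| <= `|v|.
Proof.
rewrite normrZ ler_piMr // [leLHS]/Num.norm /= mx_normrE.
apply: bigmax_le => //= -[i k] _ /=; rewrite mxE.
by case: (_ && _); rewrite ?normr1 ?normr0.
Qed.

(** The order of choices matters: [C] bounds the energy uniformly in the step, then [r'] and [e]
    depend on [C], and [s] is chosen last. *)
Lemma harnack_barrier (t1 : R) : 0 < t1 ->
  0 <= Hlim x0 t1 + phi t1 + bar x0 + del.
Proof.
move=> t10; rewrite leNgt; apply/negP => neg; have hdel := del0.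
have [|C hC] := energy_bounded (@cylinder_compact r 0 t1 r0).
  by move=> z [_] /=; rewrite in_itv /= => /andP[z0 _]; apply: lt_le_trans z0.
(* With these [r'] and [e], energy + phi + barrier is nonnegative on the lateral
   and initial boundary of the cylinder. *)
have [r' [r'0 r'r Cr']] : exists r' : R, [/\ 0 < r', r' < r & C <= barrier A r r'].
  by have [r' /andP[? ?] ?] := barrier_blowup C A0 r0; exists r'.
have [e [e0 et1 Ce]] : exists e : R, [/\ 0 < e, e < t1 & C <= phi e].
  by have [e /andP[? ?] ?] := weight_blowup W C t10; exists e.
have cyl z : cylinder r' e t1 z -> [/\ forall j, `|z.1 0 j - x0 0 j| < r,
    0 < z.2, t0 < z.2 & cylinder r 0 t1 z].
  move=> [/= zr]; rewrite in_itv /= => /andP[ez zt].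
  split.
  - by move=> j; apply: le_lt_trans (coord_le _ _) _; apply: le_lt_trans zr _.
  - exact: lt_le_trans ez.
  - by apply: lt_trans t00 _; exact: lt_le_trans ez.
  - split => /=; first by apply: le_trans zr _; exact: ltW.
    by rewrite in_itv /= zt andbT (le_trans _ ez) // ltW.
have hnb : \forall s \near (0^'+ : set_system R), cylinder r' e t1 `<=` (fun z => ~ bad s z).
  have /compact_near_coveringP := @cylinder_compact r' e t1 r'0; apply.
  by move=> z /cyl[zr z0 _ _]; exact: not_bad.
have hx0 : \forall s \near (0^'+ : set_system R),
    dH s x0 t1 < - (phi t1 + bar x0 + del).
  have FF' : Filter (near0p (x0, t1)) by apply: filter_prod_filter.
  have tz : t0 < (x0, t1).2 by apply: lt_trans t10.
  have lt1 : Hlim (x0, t1).1 (x0, t1).2 < - (phi t1 + bar x0 + del) by rewrite /=; lra.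
  have : \forall zs \near near0p (x0, t1), dH zs.2 zs.1.1 zs.1.2 < - (phi t1 + bar x0 + del).
    by apply: (@cvgr_lt _ _ _ FF' _ _ (energy_near tz)).
  move=> [[U S] [/= /nbhs_singleton Ux S0] US].
  by apply: filterS S0 => s Ss; exact: (US ((x0, t1), s) (conj Ux Ss)).
have [s [s0 [{}hC [{}hnb {}hx0]]]] : exists s : R, 0 < s /\
    (forall z, cylinder r 0 t1 z -> - C <= dH s z.1 z.2) /\
    (cylinder r' e t1 `<=` (fun z => ~ bad s z)) /\
    dH s x0 t1 < - (phi t1 + bar x0 + del).
  have s0 : \forall s \near (0^'+ : set_system R), 0 < s by exact: nbhs_right_gt.
  apply: (@filter_ex _ (0^'+ : set_system R)).
  by apply: filterI s0 _; apply: filterI hC _; apply: filterI hnb _.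
pose G (z : 'rV[R]_n * R) := dH s z.1 z.2 + phi z.2 + bar z.1.
have K0 : cylinder r' e t1 (x0, t1).
  by split => /=; rewrite ?subrr ?normr0 ?(ltW r'0) // in_itv /= lexx ltW.
have [z [Kz zmin]] : exists z : 'rV[R]_n * R, cylinder r' e t1 z /\
    forall y, cylinder r' e t1 y -> G z <= G y.
  have [||z /[!inE] Kz zmin] := @compact_EVT_min _ _ G (cylinder r' e t1) _
    (@cylinder_compact r' e t1 r'0).
  - by exists (x0, t1).
  - apply: continuous_in_subspaceT => z /[!inE] /cyl[zr z0 tz _].
    have h2 : (fun y : 'rV[R]_n * R => y.2) @ z --> z.2 by exact: cvg_snd.
    apply: cvgD; first apply: cvgD.
    + exact: energy_continuous.
    + exact: (cvg_comp _ phi h2 (weight_cont W z0)).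
    + by apply: cvg_finsum => j; apply: coord_cvg; exact: barrier_continuous.
  - by exists z; split => // y Ky; apply: zmin; rewrite inE.
have [zr z20 tz Kz'] := cyl z Kz.
have Gz : G z < - del.
  by apply: (@le_lt_trans _ _ (G (x0, t1))); [exact: zmin | rewrite /G /=; lra].
have b0z := bar_ge0 zr.
have dHz := hC z Kz'.
have phiz := weight_ge0 W z20.
have [D hD] : exists D : R, D = `|x0 - z.1| by exists `|x0 - z.1|.
move: (Kz) => [/=]; rewrite -hD in_itv /= => zr' /andP[ez zt].
have ez' : e < z.2.
  rewrite lt_neqAle ez andbT; apply/eqP => E.
  have Cz : C <= phi z.2 by rewrite -E.
  by move: Gz; rewrite /G; lra.
have zr'' : D < r'.
  rewrite lt_neqAle zr' andbT; apply/eqP => E.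
  (* The norm is the sup norm, so on the lateral boundary some coordinate is at distance [r'], and
     its barrier alone reaches [C]. *)
  have [j Ej] : exists j, `|z.1 0 j - x0 0 j| = r'.
    by have [|j Ej] := @coord_eq z.1; [rewrite -hD E | exists j; rewrite Ej -hD].
  have : C <= bar z.1.
    apply: (le_trans Cr'); rewrite /bar (bigD1 j) //=.
    have -> : barrier A r (z.1 0 j - x0 0 j) = barrier A r r'.
      by rewrite /barrier -(real_normK (num_real (z.1 0 j - x0 0 j))) Ej.
    by rewrite lerDl; apply: sumr_ge0 => i _; apply: ltW; exact: barrier_gt0.
  by move: Gz; rewrite /G; lra.
have [g [d [rho0 [rho00 gD gphi hode]]]] := weight_ode W z20.
(* Displacements shorter than [rho] stay in the cylinder, and earlier times within [rho] stay where
   [phi] agrees with [g]. *)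
pose rho : R := Num.min (r' - D) (Num.min (z.2 - e) rho0).
have rhogt0 : 0 < rho by rewrite !lt_min rho00 !subr_gt0 zr'' ez'.
have [rho1 rho2 rho3] : [/\ rho <= r' - D, rho <= z.2 - e & rho <= rho0].
  by split; rewrite /rho !ge_min lexx ?orbT.
have shiftK j (v : R) : `|v| < rho -> cylinder r' e t1 (z.1 + v *: basis_vec j, z.2).
  move=> hv; split => /=; last by rewrite in_itv /= ez zt.
  rewrite opprD addrA; apply: le_trans (ler_normB _ _) _; rewrite -hD.
  by have := norm_basis_vec v j; lra.
have shiftr j (v : R) : `|v| < rho -> `|z.1 0 j + v - x0 0 j| < r.
  move=> hv; have [+ _ _ _] := cyl _ (shiftK j v hv).
  by move=> /(_ j); rewrite !mxE !eqxx mulr1.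
have shD (B B1 : R -> R) (x v y : R) : is_derive (x + v - y) 1 B (B1 (x + v - y)) ->
    is_derive v 1 (fun v => B (x + v - y)) (B1 (x + v - y)).
  move=> BD; have h : is_derive v 1 (fun v : R => x + v - y) (1 : R).
    by apply: is_derive_eq; ring.
  by have := @is_derive1_comp R B (fun v => x + v - y) v _ _ BD h; rewrite mulr1.
have vzero x y : x + 0 - y = x - y :> R by rewrite addr0.
have hZ j (v : R) : `|v| < rho ->
    is_derive v 1 (fun v => barrier A r (z.1 0 j + v - x0 0 j))
      (barrier1 A r (z.1 0 j + v - x0 0 j)).
  by move=> hv; apply: (shD _ (barrier1 A r)); apply: barrier_derive => //; exact: shiftr.
have hZ1 j : is_derive (0 : R) 1 (fun v => barrier1 A r (z.1 0 j + v - x0 0 j))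
      (barrier2 A r (z.1 0 j - x0 0 j)).
  have := shD (barrier1 A r) (barrier2 A r) (z.1 0 j) 0 (x0 0 j).
  by rewrite vzero; apply; apply: barrier1_derive.
have hHx j (v : R) : `|v| < rho -> dH s z.1 z.2 + barrier A r (z.1 0 j + 0 - x0 0 j)
    <= dH s (z.1 + v *: basis_vec j) z.2 + barrier A r (z.1 0 j + v - x0 0 j).
  move=> hv; rewrite vzero.
  have := zmin (z.1 + v *: basis_vec j, z.2) (shiftK j v hv).
  by have := bar_move z.1 j v; rewrite /G /=; lra.
have hHt (t' : R) : z.2 - rho < t' < z.2 -> dH s z.1 z.2 + g z.2 <= dH s z.1 t' + g t'.
  move=> /andP[ht1 ht2]; have e't : e < t' by lra.
  rewrite -(gphi t') ?(lt_trans e0 e't) //; last by apply/andP; split; lra.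
  rewrite -(gphi z.2) //; last by apply/andP; split; lra.
  have := zmin (z.1, t'); rewrite /G /= => h.
  have : cylinder r' e t1 (z.1, t').
    by split => //=; rewrite ?in_itv /= -?hD //; apply/andP; split; lra.
  by move=> /h; lra.
have hmin := @discrete_min R n a b t0 al be ga s d rho l tau p q z.1 z.2
  (fun j v => barrier A r (z.1 0 j + v - x0 0 j))
  (fun j v => barrier1 A r (z.1 0 j + v - x0 0 j))
  (fun j => barrier2 A r (z.1 0 j - x0 0 j)) g LS tz (lt0r_neq0 s0) rhogt0
  hZ hZ1 gD hHx hHt.
(* The minimum point is shown to be [bad]; [hode], taken at [w = e^(2l)] and [z = N], turns [hmin]
   into the sign of the residual. *)
apply: (hnb z Kz).

have N0 : 0 <= - (dH s z.1 z.2 + phi z.2) by move: Gz; rewrite /G; lra.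
split; first by move: Gz; rewrite /G; lra.
have := hode _ _ (ltW (expR_gt0 (2 * l z.1 z.2))) N0.
have hz1 : \sum_j p j z.1 z.2 * barrier1 A r (z.1 0 j + 0 - x0 0 j) = z1 z.1 z.2.
  by apply: eq_bigr => j _; rewrite vzero.
move: hmin; rewrite /= hz1 -/(hessian s z.1 z.2) -/(reaction s z.1 z.2) -/(z2 z.1).
rewrite /residual /harnack_residual.
move: (hessian _ _ _) (reaction _ _ _) (z1 _ _) (z2 _) (dH _ _ _) => hh rr zz1 zz2 DD.
by lra.
Qed.

End Core.

Lemma harnack_core (R : realType) (n : nat) (a b t0 al be ga c c2 : R)
    (l tau : 'rV[R]_n -> R -> R) (p q : 'I_n -> 'rV[R]_n -> R -> R) (phi : R -> R) :
  log_solution a b t0 l tau p q -> t0 < 0 -> weight c ga a b c2 phi ->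
  0 < b -> 0 < be -> be < al -> 0 < c -> 0 < c2 ->
  c * al ^+ 2 * n%:R = 2 * (al - be) ->
  0 <= 2 * c * be * ga - 4 * b * al - 2 * b * be - 6 * ga ->
  forall x t, 0 < t ->
  0 <= al * \sum_i q i x t + be * \sum_i p i x t ^+ 2 + ga * expR (2 * l x t) + phi t.
Proof.
move=> LS t00 W b0 be0 beal c0 c20 hc hk x t tpos.
rewrite leNgt; apply/negP; set h := (X in X < 0) => h0.
pose A := (28 + 16 / (2 * c * be)) / c2.
have A0 : 0 < A by rewrite divr_gt0 // addr_gt0 // divr_gt0 // !mulr_gt0.
have hA : c2 * A = 28 + 16 / (2 * c * be) by rewrite mulrC divfK ?gt_eqF.
(* Chosen so that the barrier at the centre, [n A / (1 + m)^2], is at most [- h / 3]; with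
   [del = - h / 3] the sum stays negative, a contradiction. *)
pose m : R := 3 * (n%:R * A) / (- h).
have h0' : 0 < - h by lra.
have m0 : 0 <= m 
  by apply: divr_ge0; [apply: mulr_ge0 => //; apply: mulr_ge0 => //|]; exact: ltW.
have r0 : 0 < 1 + m by lra.
have del0 : 0 < - h / 3 by lra.
have := @harnack_barrier R n a b t0 al be ga c c2 l tau p q LS t00 phi W b0 be0
  beal c0 c20 hc hk x A (1 + m) (- h / 3) r0 del0 hA t tpos.
rewrite -/h /=.
have -> : \sum_j barrier A (1 + m) (x 0 j - x 0 j) = n%:R * (A / (1 + m) ^+ 2).
  rewrite (eq_bigr (fun=> A / (1 + m) ^+ 2)); last first.
    by move=> j _; rewrite /barrier subrr expr0n /= subr0; field; rewrite gt_eqF.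
  by rewrite sumr_const card_ord [RHS]mulr_natl.
have hm : n%:R * A = m * (- h / 3).
  by rewrite /m; move: (- h) h0' => y y0; field; rewrite gt_eqF.
rewrite mulrA hm.
have : m * (- h / 3) / (1 + m) ^+ 2 <= - h / 3.
  rewrite ler_pdivrMr ?exprn_gt0 // mulrC ler_pM2l //.
  by rewrite expr2; nra.
lra.
Qed.

(** * Admissible time weights *)

(** Completion of the square in [w]. For [z = 0] the right side is a pure square, which identifies
    the bracket added on the left as minus the minimum over real [w]. *)
Lemma riccati_square (R : realFieldType) (a b c ga f z w : R) : 0 < c -> ga < 0 ->
  c * (f + z + ga * w) ^+ 2 + 2 * b * w * (f + z) + 2 * a * ga * w
    + (- c * f ^+ 2 + ((c * ga + b) * f + a * ga) ^+ 2 / (c * ga ^+ 2))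
  = (c * ga ^+ 2 * w + (c * ga + b) * (f + z) + a * ga) ^+ 2 / (c * ga ^+ 2)
    - b * (2 * c * ga + b) / (c * ga ^+ 2) * (z ^+ 2 + 2 * z * f)
    - 2 * (c * ga + b) * a / (c * ga) * z.
Proof. by move=> c0 ga0; field; rewrite (lt_eqF ga0) (gt_eqF c0). Qed.

(** The coefficient of [z ^+ 2] in [riccati_square] is already positive here; the bound
    [- (a * ga) <= b * f] makes the part linear in [z] nonnegative. *)
Lemma weight_ineq_strict (R : realFieldType) (a b c ga f z w : R) :
  0 < a -> 0 < b -> 0 < c -> ga < 0 -> 2 * c * ga + b < 0 ->
  - (a * ga) <= b * f -> 0 <= z ->
  - (b * (2 * c * ga + b) / (c * ga ^+ 2)) * z ^+ 2 <=
  c * (f + z + ga * w) ^+ 2 + 2 * b * w * (f + z) + 2 * a * ga * w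
    + (- c * f ^+ 2 + ((c * ga + b) * f + a * ga) ^+ 2 / (c * ga ^+ 2)).
Proof.
move=> a0 b0 c0 ga0 B0 hf z0; rewrite riccati_square //.
have cg : 0 < c * ga ^+ 2 by rewrite mulr_gt0 // exprn_even_gt0 //= lt_eqF.
have h1 : 0 <= (c * ga ^+ 2 * w + (c * ga + b) * (f + z) + a * ga) ^+ 2 / (c * ga ^+ 2).
  by rewrite divr_ge0 ?sqr_ge0 // ltW.
have h2 : 0 <= (- (b * (2 * c * ga + b)) * f - (c * ga + b) * a * ga) / (c * ga ^+ 2).
  apply: divr_ge0; last exact: ltW.
  have : 0 <= - (2 * c * ga + b) * (b * f + a * ga) by apply: mulr_ge0; lra.
  have : 0 <= a * (c * ga ^+ 2) by rewrite mulr_ge0 // ltW.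
  by lra.
have h3 := mulr_ge0 z0 h2.
have E : z * ((- (b * (2 * c * ga + b)) * f - (c * ga + b) * a * ga) / (c * ga ^+ 2))
   = - (b * (2 * c * ga + b) / (c * ga ^+ 2)) * (z * f) - (c * ga + b) * a / (c * ga) * z.
  by field; rewrite (lt_eqF ga0) (gt_eqF c0).
by lra.
Qed.

(** The polynomial is nondecreasing in [w >= 0], so its worst case is [w = 0]. *)
Lemma weight_ineq_early (R : realFieldType) (a b c ga f z w : R) :
  0 < c -> 0 <= c * ga + b -> 0 <= f -> 0 <= (c * ga + b) * f + a * ga ->
  0 <= z -> 0 <= w ->
  c * z ^+ 2 <=
  c * (f + z + ga * w) ^+ 2 + 2 * b * w * (f + z) + 2 * a * ga * w + - c * f ^+ 2.
Proof.
move=> c0 g0 f0 hf z0 w0.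
have h1 : 0 <= w * ((c * ga + b) * f + a * ga) by exact: mulr_ge0.
have h2 : 0 <= (c * ga + b) * (w * z) by rewrite mulr_ge0 // mulr_ge0.
have h3 : 0 <= c * (f * z) by rewrite mulr_ge0 ?(ltW c0) // mulr_ge0.
have h4 : 0 <= c * (ga * w) ^+ 2 by rewrite mulr_ge0 ?(ltW c0) // sqr_ge0.
by lra.
Qed.

Lemma weight_ineq_late (R : realFieldType) (a b c ga f z w : R) :
  0 < a -> 0 < b -> 0 < c -> ga < 0 -> 0 <= 2 * c * ga + b -> 0 <= f ->
  (c * ga + b) * f + a * ga <= 0 -> 0 <= z -> 0 <= w ->
  c * z ^+ 2 <=
  c * (f + z + ga * w) ^+ 2 + 2 * b * w * (f + z) + 2 * a * ga * w
    + (- c * f ^+ 2 + ((c * ga + b) * f + a * ga) ^+ 2 / (c * ga ^+ 2)).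
Proof.
move=> a0 b0 c0 ga0 B0 f0 hf z0 w0.
have cga : c * ga < 0 by rewrite pmulr_rlt0.
have g0 : 0 < c * ga + b by lra.
have cg : 0 < c * ga ^+ 2 by rewrite mulr_gt0 // exprn_even_gt0 //= lt_eqF.
have [hq|hq] := leP 0 ((c * ga + b) * (f + z) + a * ga).
  have h0 : 0 <= ((c * ga + b) * f + a * ga) ^+ 2 / (c * ga ^+ 2).
    by rewrite divr_ge0 ?sqr_ge0 // ltW.
  have h1 : 0 <= w * ((c * ga + b) * (f + z) + a * ga) by exact: mulr_ge0.
  have h3 : 0 <= c * (f * z) by rewrite mulr_ge0 ?(ltW c0) // mulr_ge0.
  have h4 : 0 <= c * (ga * w) ^+ 2 by rewrite mulr_ge0 ?(ltW c0) // sqr_ge0.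
  by lra.
rewrite riccati_square //.
have h1 : 0 <= (c * ga ^+ 2 * w + (c * ga + b) * (f + z) + a * ga) ^+ 2 / (c * ga ^+ 2).
  by rewrite divr_ge0 ?sqr_ge0 // ltW.
pose u := - (a * ga) / (c * ga + b).
have hu x : (c * ga + b) * x + a * ga <= 0 -> x <= u.
  by move=> hx; rewrite /u ler_pdivlMr //; lra.
have fu := hu _ hf; have qu := hu _ (ltW hq).
have h2 : 0 <= b * (2 * c * ga + b) / (c * ga ^+ 2) * (z * (2 * u - (z + 2 * f))).
  apply: mulr_ge0; first by rewrite divr_ge0 ?(ltW cg) // mulr_ge0 // ltW.
  by apply: mulr_ge0 => //; lra.
have h3 : 0 <= c * (z * (u - z)).
  by rewrite mulr_ge0 ?(ltW c0) // mulr_ge0 //; lra.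
have h3' : 0 <= c * (z * u).
  by rewrite mulr_ge0 ?(ltW c0) // mulr_ge0 //; lra.
have E : b * (2 * c * ga + b) / (c * ga ^+ 2) * (z * (2 * u))
   + 2 * (c * ga + b) * a / (c * ga) * z = - (2 * c * (z * u)).
  by rewrite /u; field; rewrite (lt_eqF ga0) (gt_eqF c0) (gt_eqF g0).
by lra.
Qed.

(** With [c = 2 (alpha - beta) / (n alpha^2)], [riccati_weight] is the function [phi]
    of the theorem and [glued_weight], with [T] the switching time, is [psi];
    neither depends on [alpha] and [beta] otherwise. *)
Definition riccati_weight (R : realType) (c ga a b t : R) : R :=
  a * ga * (expR (2 * a * t) / b - (2 * c * ga + b)^-1) / (1 - expR (2 * a * t)).

Definition late_weight (R : realType) (c ga a b T t : R) : R :=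
  - (a * ga * (expR (2 * a * (t - T)) + 1))
    / (b * (expR (2 * a * (t - T)) + 1) + 2 * c * ga).

Definition glued_weight (R : realType) (c ga a b T t : R) : R :=
  if t <= T then (c * t)^-1 else late_weight c ga a b T t.

Lemma is_derive_continuous (R : realType) (g : R -> R) (t d : R) :
  is_derive t 1 g d -> {for t, continuous g}.
Proof. by move=> [gd _]; apply: differentiable_continuous; apply/derivable1_diffP. Qed.

Lemma is_derive_expR_affine (R : realType) (k m t : R) :
  is_derive t 1 (fun t => expR (k * (t - m))) (k * expR (k * (t - m))).
Proof.
have h : is_derive t 1 (fun t : R => k * (t - m)) k.
  by apply: is_derive_eq; rewrite /GRing.scale /=; ring.
have h2 := @is_derive1_comp R expR (fun t => k * (t - m)) t _ _ (is_derive_expR _) h.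
by apply: (is_derive_eq h2); rewrite mulrC.
Qed.

Lemma is_derive_quot (R : realType) (u v : R -> R) (t u' v' : R) :
  v t != 0 -> is_derive t 1 u u' -> is_derive t 1 v v' ->
  is_derive t 1 (fun t => u t / v t) ((u' * v t - u t * v') / v t ^+ 2).
Proof.
move=> v0 uD vD; have h := is_deriveV v0 vD.
by apply: is_derive_eq; rewrite /GRing.scale /=; field.
Qed.

Section Weights.
Context (R : realType) (a b c ga : R).
Context (a0 : 0 < a) (b0 : 0 < b) (c0 : 0 < c) (ga0 : ga < 0).

Lemma riccati_weight_derive (t : R) : 0 < t -> 2 * c * ga + b != 0 ->
  let f := riccati_weight c ga a b t in
  is_derive t 1 (riccati_weight c ga a b)
    (- c * f ^+ 2 + ((c * ga + b) * f + a * ga) ^+ 2 / (c * ga ^+ 2)).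
Proof.
move=> t0 B0 f.
have E1 : 1 < expR (2 * a * t) by rewrite expR_gt1 !mulr_gt0.
have den : 1 - expR (2 * a * t) != 0 by rewrite subr_eq0 lt_eqF.
have h := is_derive_expR_affine (2 * a) 0 t.
rewrite subr0 in h.
have {}h : is_derive t 1 (fun t : R => expR (2 * a * t)) (2 * a * expR (2 * a * t)).
  by rewrite (_ : (fun t => _) = fun t => expR (2 * a * (t - 0))) //;
    apply/funext => x; rewrite subr0.
have h1 : is_derive t 1
    (fun t : R => a * ga * (expR (2 * a * t) / b - (2 * c * ga + b)^-1))
    (a * ga * (2 * a * expR (2 * a * t) / b)).
  rewrite (_ : (fun t : R => _) = fun t => (a * ga / b) * expR (2 * a * t)
     - a * ga / (2 * c * ga + b)); last by apply/funext => x; ring.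
  by apply: is_derive_eq; rewrite /GRing.scale /=; ring.
have h2 : is_derive t 1 (fun t : R => 1 - expR (2 * a * t)) (- (2 * a * expR (2 * a * t))).
  by apply: is_derive_eq; rewrite /GRing.scale /=; ring.
have h3 := is_derive_quot (v := fun t => 1 - expR (2 * a * t)) den h1 h2.
apply: (is_derive_eq h3); rewrite /f /riccati_weight.
move: (expR _) den => E den; field.
by rewrite den B0 (gt_eqF b0) (gt_eqF c0) (lt_eqF ga0).
Qed.

Lemma late_weight_derive (T t : R) :
  b * (expR (2 * a * (t - T)) + 1) + 2 * c * ga != 0 ->
  let f := late_weight c ga a b T t in
  is_derive t 1 (late_weight c ga a b T)
    (- c * f ^+ 2 + ((c * ga + b) * f + a * ga) ^+ 2 / (c * ga ^+ 2)).
Proof.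
move=> den f; have h := is_derive_expR_affine (2 * a) T t.
have h1 : is_derive t 1 (fun t : R => - (a * ga * (expR (2 * a * (t - T)) + 1)))
    (- (a * ga * (2 * a * expR (2 * a * (t - T))))).
  by apply: is_derive_eq; rewrite /GRing.scale /=; ring.
have h2 : is_derive t 1 (fun t : R => b * (expR (2 * a * (t - T)) + 1) + 2 * c * ga)
    (b * (2 * a * expR (2 * a * (t - T)))).
  by apply: is_derive_eq; rewrite /GRing.scale /=; ring.
have h3 := is_derive_quot
  (v := fun t => b * (expR (2 * a * (t - T)) + 1) + 2 * c * ga) den h1 h2.
apply: (is_derive_eq h3); rewrite /f /late_weight.
move: (expR _) den => E den; field.
by rewrite den (gt_eqF c0) (lt_eqF ga0).
Qed.

Lemma weight_riccati : 2 * c * ga + b < 0 ->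
  weight c ga a b (- (b * (2 * c * ga + b) / (c * ga ^+ 2))) (riccati_weight c ga a b).
Proof.
move=> B0; set B := 2 * c * ga + b in B0 *.
have aga : 0 < - (a * ga) by rewrite oppr_gt0 pmulr_rlt0.
have iB : B^-1 < 0 by rewrite invr_lt0.
have Bn0 : B != 0 by rewrite lt_eqF.
(* Splits off the limit [- (a * ga) / b] at large times; the positive remainder gives both the lower
   bound and the blow-up at 0. *)
have form (t : R) : 0 < t -> exists E : R, [/\ E = expR (2 * a * t), 1 < E &
    riccati_weight c ga a b t
    = - (a * ga) / b + - (a * ga) * (b^-1 - B^-1) / (E - 1)].
  move=> t0; exists (expR (2 * a * t)).
  have E1 : 1 < expR (2 * a * t) by rewrite expR_gt1 !mulr_gt0.
  split => //; rewrite /riccati_weight -/B; move: (expR _) E1 => E E1.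
  by field; rewrite (gt_eqF b0) (lt_eqF B0) !subr_eq0 (lt_eqF E1) (gt_eqF E1).
have ib : 0 < b^-1 by rewrite invr_gt0.
have K0 : 0 < - (a * ga) * (b^-1 - B^-1) by rewrite mulr_gt0 //; lra.
have lower (t : R) : 0 < t -> - (a * ga) <= b * riccati_weight c ga a b t.
  move=> /form[E [_ E1 ->]]; rewrite mulrDr (mulrC b (_ / b)) divfK ?gt_eqF // lerDl.
  by rewrite mulr_ge0 ?(ltW b0) // divr_ge0 ?(ltW K0) // subr_ge0 ltW.
split.
- move=> t /lower h; have : 0 <= b * riccati_weight c ga a b t by lra.
  by rewrite pmulr_rge0.
- by move=> t t0; exact: (is_derive_continuous (riccati_weight_derive t0 Bn0)).
- move=> C t t0; set K := - (a * ga) * (b^-1 - B^-1) in K0 form.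
  pose C' := Num.max C 1; have C'0 : 0 < C' by rewrite lt_max ltr01 orbT.
  have KC : 0 < K / C' by rewrite divr_gt0.
  have ln0 : 0 < ln (1 + K / C') by rewrite ln_gt0 // ltrDl.
  pose e := Num.min (t / 2) (ln (1 + K / C') / (2 * a)).
  have e0 : 0 < e by rewrite lt_min !divr_gt0 // mulr_gt0.
  have [e1 e2] : e <= t / 2 /\ e <= ln (1 + K / C') / (2 * a).
    by split; rewrite /e ge_min lexx ?orbT.
  exists e; first by rewrite e0 /=; lra.
  have [E [EE E1 ->]] := form e e0.
  have E2 : E <= 1 + K / C'.
    have <- : expR (ln (1 + K / C')) = 1 + K / C' by rewrite lnK // posrE addr_gt0.
    rewrite EE ler_expR.
    by move: e2; rewrite ler_pdivlMr ?mulr_gt0 // mulrC.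
  have h : C' <= K / (E - 1).
    rewrite ler_pdivlMr ?subr_gt0 //.
    have : E - 1 <= K / C' by lra.
    by rewrite ler_pdivlMr // mulrC.
  have : C <= C' by rewrite le_max lexx.
  have : 0 <= - (a * ga) / b by rewrite divr_ge0 // ltW.
  by lra.
- move=> t t0; exists (riccati_weight c ga a b); eexists; exists 1; split.
  + exact: ltr01.
  + exact: (riccati_weight_derive t0 Bn0).
  + by [].
  + by move=> w z w0 z0; apply: weight_ineq_strict => //; exact: lower.
Qed.

Lemma glued_continuous (f1 f2 : R -> R) (T t : R) :
  (t <= T -> {for t, continuous f1}) -> (T <= t -> {for t, continuous f2}) ->
  f1 T = f2 T -> {for t, continuous (fun x => if x <= T then f1 x else f2 x)}.
Proof.
move=> h1 h2 E; apply/cvgrPdist_lt => eps eps0.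
have [tT|tT|tT] := ltgtP t T.
- have /cvgrPdist_lt/(_ _ eps0) := h1 (ltW tT).
  have := lt_nbhsl tT; apply: filterS2 => x xT.
  by rewrite (ltW xT).
- have /cvgrPdist_lt/(_ _ eps0) := h2 (ltW tT).
  have := lt_nbhsr tT; apply: filterS2 => x xT.
  by rewrite leNgt xT.
- subst t; have /cvgrPdist_lt/(_ _ eps0) := h1 (lexx T).
  have /cvgrPdist_lt/(_ _ eps0) := h2 (lexx T); apply: filterS2 => x.
  by rewrite -E; case: ifP.
Qed.

(** At [T] both branches equal [- (a * ga) / (c * ga + b)], the value at which the linear
    coefficient in [w] changes sign; before [T] the weight is above it, afterwards below. *)
Lemma weight_glued : 0 <= 2 * c * ga + b ->
  weight c ga a b c (glued_weight c ga a b ((c * ga + b) / (- (a * c * ga)))).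
Proof.
move=> B0; set g := c * ga + b; set T := g / _.
have cga : c * ga < 0 by rewrite pmulr_rlt0.
have g0 : 0 < g by rewrite /g; lra.
have aga : 0 < - (a * ga) by rewrite oppr_gt0 pmulr_rlt0.
have acga : 0 < - (a * c * ga) by rewrite -mulrA oppr_gt0 pmulr_rlt0.
have T0 : 0 < T by rewrite divr_gt0.
have den0 (t : R) : 0 < b * (expR (2 * a * (t - T)) + 1) + 2 * c * ga.
  have : 0 < b * expR (2 * a * (t - T)) by rewrite mulr_gt0 // expR_gt0.
  by lra.
have late_ge0 (t : R) : 0 <= late_weight c ga a b T t.
  rewrite /late_weight -mulNr; apply: divr_ge0; last exact: ltW.
  by apply: mulr_ge0; rewrite ltW // addr_gt0 // expR_gt0.
have lateT : late_weight c ga a b T T = (c * T)^-1.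
  rewrite /late_weight subrr mulr0 expR0 /T /g; field.
  rewrite (lt_eqF ga0) (gt_eqF c0) (gt_eqF a0) (gt_eqF g0) /=.
  have : 0 < b * (1 + 1) + 2 * c * ga by move: g0; rewrite /g; lra.
  by move/gt_eqF => ->.
have late_le (t : R) : T <= t -> g * late_weight c ga a b T t + a * ga <= 0.
  move=> Tt; have := den0 t.
  have : 1 <= expR (2 * a * (t - T)).
    by rewrite -expR0 ler_expR mulr_ge0 ?subr_ge0 // mulr_ge0 // ltW.
  rewrite /late_weight; move: (expR _) => E E1 den.
  have -> : g * (- (a * ga * (E + 1)) / (b * (E + 1) + 2 * c * ga)) + a * ga
    = a * ga * (- (c * ga) * (E - 1)) / (b * (E + 1) + 2 * c * ga).
    by rewrite /g; field; rewrite gt_eqF.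
  rewrite ler_pdivrMr // mul0r; apply: mulr_le0_ge0; first lra.
  by apply: mulr_ge0; lra.
have inv_derive (t : R) : 0 < t -> is_derive t 1 (fun t : R => (c * t)^-1)
    (- c * (c * t)^-1 ^+ 2).
  move=> t0; have ct : c * t != 0 by rewrite gt_eqF // mulr_gt0.
  have h : is_derive t 1 (fun t : R => c * t) c.
    by apply: is_derive_eq; rewrite /GRing.scale /=; ring.
  have h2 := @is_deriveV R (fun t => c * t) t _ 1 ct h.
  apply: (is_derive_eq h2); rewrite /GRing.scale /= exprVn; ring.
have late_cont (t : R) : {for t, continuous (late_weight c ga a b T)}.
  exact: (is_derive_continuous (late_weight_derive (lt0r_neq0 (den0 t)))).
split.
- move=> t t0; rewrite /glued_weight; case: ifP => // _.
  by rewrite invr_ge0 ltW // mulr_gt0.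
- move=> t t0; apply: glued_continuous => // _.
  exact: (is_derive_continuous (inv_derive t t0)).
- move=> C t t0; pose C' := Num.max C 1.
  have C'0 : 0 < C' by rewrite lt_max ltr01 orbT.
  pose e := Num.min (t / 2) (Num.min T (c * C')^-1).
  have e0 : 0 < e by rewrite !lt_min T0 invr_gt0 divr_gt0 //= mulr_gt0.
  have [e1 e2 e3] : [/\ e <= t / 2, e <= T & e <= (c * C')^-1].
    by split; rewrite /e !ge_min lexx ?orbT.
  exists e; first by rewrite e0 /=; lra.
  rewrite /glued_weight e2; apply: (@le_trans _ _ C'); first by rewrite le_max lexx.
  rewrite -[C']invrK lef_pV2 ?posrE ?invr_gt0 ?mulr_gt0 //.
  have -> : C'^-1 = c * (c * C')^-1 by rewrite invfM mulrA divff ?mul1r ?gt_eqF.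
  by rewrite ler_pM2l.
- move=> t t0; have [tT|Tt] := leP t T.
    exists (fun t => (c * t)^-1); exists (- c * (c * t)^-1 ^+ 2); exists 1; split.
    + exact: ltr01.
    + exact: inv_derive.
    + by move=> r /andP[_ rt] _; rewrite /glued_weight (le_trans rt tT).
    + move=> w z w0 z0; rewrite /glued_weight tT.
      apply: weight_ineq_early => //; first exact: ltW.
        by rewrite invr_ge0 ltW // mulr_gt0.
      move: tT; rewrite /T ler_pdivlMr // => tT.
      have -> : g / (c * t) + a * ga = (g - t * - (a * c * ga)) / (c * t).
        by field; rewrite (gt_eqF c0) (gt_eqF t0).
      by rewrite divr_ge0 ?subr_ge0 // ltW // mulr_gt0.
  exists (late_weight c ga a b T); eexists; exists (t - T); split.
  + by rewrite subr_gt0.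
  + exact: (late_weight_derive (lt0r_neq0 (den0 t))).
  + move=> r /andP[+ _] _; rewrite subKr => Tr.
    by rewrite /glued_weight leNgt Tr.
  + move=> w z w0 z0; rewrite /glued_weight (leNgt t T) Tt /=.
    by apply: weight_ineq_late => //; apply: late_le; exact: ltW.
Qed.

End Weights.

(** * Logarithm of a solution *)

Lemma line_quotient (R : realType) (V : normedModType R) (u : V -> R) (x e : V) (r : R) :
  (fun h : R => h^-1 *: (((fun r : R => u (x + r *: e)) \o shift r) (h *: 1)
      - u (x + r *: e)))
  = (fun h : R => h^-1 *: ((u \o shift (x + r *: e)) (h *: e) - u (x + r *: e))).
Proof.
apply/funext => h /=; congr (_ *: (u _ - _)).
by rewrite [_%:A]mulr1 scalerDl addrCA.
Qed.

Lemma derivable_line (R : realType) (V : normedModType R) (u : V -> R) (e : V) :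
  (forall x, derivable u x e) -> line_derivative u (fun x => 'D_e u x) e.
Proof.
move=> uD x r; apply: DeriveDef; first by rewrite /derivable line_quotient; exact: uD.
by rewrite /derive line_quotient.
Qed.

Lemma line_derive (R : realType) (V : normedModType R) (u u1 : V -> R) (e : V) :
  line_derivative u u1 e -> forall x, 'D_e u x = u1 x.
Proof.
move=> uD x; have [_] := uD x 0; rewrite /derive line_quotient scale0r addr0.
by [].
Qed.

Lemma is_derive_ln (R : realType) (g : R -> R) (r g' : R) :
  0 < g r -> is_derive r 1 g g' -> is_derive r 1 (fun r => ln (g r)) (g' / g r).
Proof.
move=> g0 gD; have h := is_derive1_comp (is_derive1_ln g0) gD.
by apply: (is_derive_eq h); rewrite mulrC.
Qed.

Lemma log_solution_ln (R : realType) (n : nat) (a b : R) (f : 'rV[R]_n -> R -> R) :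
  classical_NW_solution a b f -> (forall x t, 0 <= t -> 0 < f x t) ->
  log_solution a b 0 (fun x t => ln (f x t)) (fun x t => derive1 (f x) t / f x t)
    (fun i x t => pderiv i (f^~ t) x / f x t)
    (fun i x t => pderiv i (pderiv i (f^~ t)) x / f x t
                  - (pderiv i (f^~ t) x / f x t) ^+ 2).
Proof.
move=> [reg pde] fpos.
have f0 x t : 0 < t -> 0 < f x t by move=> /ltW; exact: fpos.
have fD i (t : R) : 0 < t ->
    line_derivative (f^~ t) (pderiv i (f^~ t)) (basis_vec i).
  by move=> t0; apply: derivable_line => x; exact: regular21_dx.
have fDD i (t : R) : 0 < t ->
    line_derivative (pderiv i (f^~ t)) (pderiv i (pderiv i (f^~ t))) (basis_vec i).
  by move=> t0; apply: derivable_line => x; exact: regular21_dxx.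
have fc (z : 'rV[R]_n * R) : 0 < z.2 ->
    {for z, continuous (fun y : 'rV[R]_n * R => f y.1 y.2)}.
  move=> z0; have Uo : open [set y : 'rV[R]_n * R | 0 < y.2].
    by apply: (@open_comp _ _ (@snd 'rV[R]_n R) [set t | 0 < t]);
      [move=> y _; exact: cvg_snd | exact: open_gt].
  have : {within [set y : 'rV[R]_n * R | 0 < y.2],
      continuous (fun y : 'rV[R]_n * R => f y.1 y.2)}.
    by apply: continuous_subspaceW (regular21_cont reg) => y /= /ltW.
  by rewrite continuous_open_subspace // => /(_ z); rewrite inE; exact.
have fic (z : 'rV[R]_n * R) : 0 < z.2 ->
    (fun y : 'rV[R]_n * R => (f y.1 y.2)^-1) @ z --> (f z.1 z.2)^-1.
  by move=> z0; apply: cvgV; [rewrite gt_eqF // f0 | exact: fc].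
have pc i (z : 'rV[R]_n * R) : 0 < z.2 ->
    {for z, continuous (fun y : 'rV[R]_n * R => pderiv i (f^~ y.2) y.1)}.
  by case: z => x t t0; exact: (regular21_dx_cont reg t0).
have qc i (z : 'rV[R]_n * R) : 0 < z.2 ->
    {for z, continuous (fun y : 'rV[R]_n * R => pderiv i (pderiv i (f^~ y.2)) y.1)}.
  by case: z => x t t0; exact: (regular21_dxx_cont reg t0).
split.
- by move=> i t t0 x r; apply: is_derive_ln; [exact: f0 | exact: fD].
- move=> i t t0 x r; have fx := lt0r_neq0 (f0 (x + r *: basis_vec i) t t0).
  apply: (is_derive_eq (is_derive_quot fx (fDD i t t0 x r) (fD i t t0 x r))).
  by field.
- move=> x t t0; apply: is_derive_ln; first exact: f0.
  by rewrite derive1E; apply: derivableP; exact: regular21_dt.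
- move=> z z0; have zp : 0 < f z.1 z.2 by exact: f0.
  exact: (cvg_comp _ (@ln R) (fc z z0) (continuous_ln zp)).
- by move=> i z z0; apply: cvgM; [exact: pc | exact: fic].
- move=> i z z0; apply: cvgB.
    by apply: cvgM; [exact: qc | exact: fic].
  by apply: cvg_sqr; apply: cvgM; [exact: pc | exact: fic].
- move=> x t t0; rewrite pde // /laplacian.
  under [X in _ = X + _ - _]eq_bigr do rewrite subrK.
  rewrite -mulr_suml [2 * _]mulr_natl -lnXn ?f0 // lnK ?posrE ?exprn_gt0 ?f0 //.
  by field; rewrite gt_eqF // f0.
Qed.

Lemma log_solution_shift (R : realType) (n : nat) (a b eps : R)
    (l tau : 'rV[R]_n -> R -> R) (p q : 'I_n -> 'rV[R]_n -> R -> R) :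
  log_solution a b 0 l tau p q ->
  log_solution a b (- eps) (fun x t => l x (t + eps)) (fun x t => tau x (t + eps))
    (fun i x t => p i x (t + eps)) (fun i x t => q i x (t + eps)).
Proof.
move=> LS; have pos (t : R) : - eps < t -> 0 < t + eps by rewrite -ltrBlDr sub0r.
have sc (u : 'rV[R]_n -> R -> R) (z : 'rV[R]_n * R) :
    {for (z.1, z.2 + eps), continuous (fun y : 'rV[R]_n * R => u y.1 y.2)} ->
    {for z, continuous (fun y : 'rV[R]_n * R => u y.1 (y.2 + eps))}.
  move=> uc.
  have h1 : (fun y : 'rV[R]_n * R => y.1) @ z --> z.1 by exact: cvg_fst.
  have h2 : (fun y : 'rV[R]_n * R => y.2 + eps) @ z --> z.2 + eps.
    by apply: cvgD; [exact: cvg_snd | exact: cvg_cst].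
  exact: (cvg_comp _ (fun y : 'rV[R]_n * R => u y.1 y.2) (cvg_pair h1 h2) uc).
split.
- by move=> i t /pos; exact: (ls_dx LS).
- by move=> i t /pos; exact: (ls_dxx LS).
- move=> x t /pos t0.
  have h := @is_derive1_comp R (l x) (shift eps) t _ _ (ls_dt LS x t0)
    (is_derive_shift t 1 eps).
  by apply: (is_derive_eq h); rewrite mulr1.
- by move=> z /pos z0; apply: sc; exact: (ls_cont LS).
- by move=> i z /pos z0; apply: (sc (p i)); exact: (ls_dx_cont LS).
- by move=> i z /pos z0; apply: (sc (q i)); exact: (ls_dxx_cont LS).
- by move=> x t /pos; exact: (ls_eq LS).
Qed.

(** Derivatives of [l] are controlled only for positive times, whereas [harnack_core] needs them
    continuous down to time 0. The solution is therefore started at time [eps], which gives the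
    bound with [phi (t - eps)]; continuity of [phi] concludes. *)
Lemma harnack_gradient (R : realType) (n : nat) (a b al be ga c c2 : R)
    (l tau : 'rV[R]_n -> R -> R) (p q : 'I_n -> 'rV[R]_n -> R -> R) (phi : R -> R) :
  log_solution a b 0 l tau p q -> weight c ga a b c2 phi ->
  0 < b -> 0 < be -> be < al -> 0 < c -> 0 < c2 ->
  c * al ^+ 2 * n%:R = 2 * (al - be) ->
  0 <= 2 * c * be * ga - 4 * b * al - 2 * b * be - 6 * ga ->
  forall x t, 0 < t ->
  0 <= al * \sum_i q i x t + be * \sum_i p i x t ^+ 2 + ga * expR (2 * l x t) + phi t.
Proof.
move=> LS W b0 be0 beal c0 c20 hc hk x t t0.
rewrite leNgt; apply/negP; set h := _ + ga * _ => h0.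
have lt1 : phi t < - h by lra.
have [rho /= rho0 hrho] := cvgr_lt _ (weight_cont W t0) _ lt1.
pose eps : R := Num.min (rho / 2) (t / 2).
have eps0 : 0 < eps by rewrite lt_min !divr_gt0.
have [eps1 eps2] : eps <= rho / 2 /\ eps <= t / 2.
  by rewrite /eps !ge_min !lexx orbT.
have te : 0 < t - eps by lra.
have := harnack_core (log_solution_shift eps LS) _ W b0 be0 beal c0 c20 hc hk x te.
rewrite oppr_lt0 subrK -/h => /(_ eps0).
have := hrho (t - eps); rewrite /= opprB addrC subrK gtr0_norm // => /(_ _) h1.
have {}h1 : phi (t - eps) < - h by apply: h1; lra.
by lra.
Qed.

(** * Conclusion *)

Lemma ge0_of_perturbation (R : realFieldType) (h k : R) :
  (forall s, 0 < s -> s <= 2^-1 -> 0 <= h + s * k) -> 0 <= h.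
Proof.
move=> H; rewrite leNgt; apply/negP => h0.
have k0 : 0 < 2 * (`|k| + 1) by have := normr_ge0 k; lra.
pose s := Num.min 2^-1 (- h / (2 * (`|k| + 1))).
have s0 : 0 < s by rewrite lt_min invr_gt0 ltr0n /= divr_gt0 // oppr_gt0.
have [s1 s2] : s <= 2^-1 /\ s <= - h / (2 * (`|k| + 1)).
  by rewrite /s !ge_min !lexx orbT.
have := H s s0 s1; move: s2; rewrite ler_pdivlMr // => s2.
have : s * k <= s * `|k| by rewrite ler_pM2l // ler_norm.
by lra.
Qed.

Section Nonnegative.
Context (R : realType) (n : nat) (a b al be ga c : R).
Context (l tau : 'rV[R]_n -> R -> R) (p q : 'I_n -> 'rV[R]_n -> R -> R).
Context (LS : log_solution a b 0 l tau p q).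
Context (n1 : (1 <= n)%N) (a0 : 0 < a) (b0 : 0 < b) (be0 : 0 <= be) (beal : be < al).
Context (c0 : 0 < c) (ga0 : ga < 0).
Context (hc : c * al ^+ 2 * n%:R = 2 * (al - be)).
Context (hk : 0 <= 2 * c * be * ga - 4 * b * al - 2 * b * be - 6 * ga).

(* For [be = 0], replacing [al], [be] by [al (1 - s)], [al s (1 - s)] leaves [c], hence
   the weight, unchanged. *)
Let perturbed_scale (s : R) : be = 0 ->
  c * (al * (1 - s)) ^+ 2 * n%:R = 2 * (al * (1 - s) - al * s * (1 - s)).
Proof.
move=> E; have hc' := hc; rewrite E subr0 in hc'.
rewrite (_ : c * (al * (1 - s)) ^+ 2 * n%:R = c * al ^+ 2 * n%:R * (1 - s) ^+ 2).
  by rewrite hc'; ring.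
ring.
Qed.

Let perturbed_bounds (s : R) : 0 < s -> s <= 2^-1 -> be = 0 ->
  0 < al * s * (1 - s) /\ al * s * (1 - s) < al * (1 - s).
Proof.
move=> s0 s1 E; have al0 : 0 < al by rewrite -E.
have s2 : 0 < 1 - s by lra.
split; first by rewrite !mulr_gt0.
by rewrite ltr_pM2r // gtr_pMr //; lra.
Qed.

Lemma harnack_riccati (x : 'rV[R]_n) (t : R) : 2 * c * ga + b < 0 -> 0 < t ->
  0 <= al * \sum_i q i x t + be * \sum_i p i x t ^+ 2 + ga * expR (2 * l x t)
       + riccati_weight c ga a b t.
Proof.
move=> B0 t0.
have c2pos (g : R) : g < 0 -> 2 * c * g + b < 0 ->
    0 < - (b * (2 * c * g + b) / (c * g ^+ 2)).
  move=> g0 B; rewrite oppr_gt0 pmulr_llt0; first by rewrite pmulr_rlt0.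
  by rewrite invr_gt0 mulr_gt0 // exprn_even_gt0 //= lt_eqF.
have [be_gt0|be_le0] := ltP 0 be.
  exact: (harnack_gradient LS (weight_riccati a0 b0 c0 ga0 B0) b0 be_gt0
    beal c0 (c2pos _ ga0 B0) hc hk).
have E : be = 0 by apply/eqP; rewrite eq_le be_le0 be0.
have al0 : 0 < al by rewrite -E.
set S := \sum_i q i x t; set y := \sum_i p i x t ^+ 2; set w := expR _.
have y0 : 0 <= y by apply: sumr_ge0 => i _; exact: sqr_ge0.
(* The first order coefficient in [s] of the perturbed inequality; the remaining term
   [- al * s ^+ 2 * y] has a favourable sign. *)
apply: (@ge0_of_perturbation _ _
  (- (al * S) + al * y + ga * w + riccati_weight c ga a b t)) => s s0 s1.
have [be'0 be'al] := perturbed_bounds s0 s1 E.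
have ga'0 : ga * (1 + s) < 0 by rewrite pmulr_llt0 //; lra.
have cga : c * ga < 0 by rewrite pmulr_rlt0.
have B' : 2 * c * (ga * (1 + s)) + b < 0.
  have : c * ga * s < 0 by rewrite pmulr_llt0.
  by lra.
have cal : 0 < c * al <= 2.
  rewrite mulr_gt0 //=; have : c * al * n%:R = 2.
    apply: (mulIf (lt0r_neq0 al0)); have := hc; rewrite E; lra.
  move=> <-; rewrite ler_peMr ?mulr_ge0 ?(ltW c0) ?(ltW al0) //.
  by rewrite ler1n.
(* [hk] may be an equality, and a positive [be] costs [2 * c * be * ga]. Enlarging [- ga] by the
   factor [1 + s] pays for it, because [c * al <= 2]. *)
have hk' : 0 <= 2 * c * (al * s * (1 - s)) * (ga * (1 + s)) - 4 * b * (al * (1 - s))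
    - 2 * b * (al * s * (1 - s)) - 6 * (ga * (1 + s)).
  have hk0 := hk; rewrite E !mulr0 mul0r subr0 sub0r in hk0.
  have h1 : 0 <= b * al * (s + s ^+ 2).
    by rewrite mulr_ge0 ?mulr_ge0 ?(ltW b0) ?(ltW al0) // addr_ge0 ?sqr_ge0 // ltW.
  have h2 : 0 <= (2 - c * al) * (s * (1 - s) * (1 + s)) * (- ga).
    have [_ cal2] := andP cal.
    rewrite mulr_ge0 ?oppr_ge0 ?(ltW ga0) // mulr_ge0 ?subr_ge0 //.
    by rewrite !mulr_ge0 //; lra.
  have h3 : 0 <= (s + 2 * s ^+ 3) * (- ga).
    rewrite mulr_ge0 ?oppr_ge0 ?(ltW ga0) // addr_ge0 ?(ltW s0) //.
    by rewrite mulr_ge0 // exprn_ge0 // ltW.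
  by lra.
have := harnack_gradient LS (weight_riccati a0 b0 c0 ga'0 B') b0 be'0
    be'al c0 (c2pos _ ga'0 B') (perturbed_scale s E) hk' x t0.
rewrite -/S -/y -/w => h.
have hw : riccati_weight c (ga * (1 + s)) a b t <= (1 + s) * riccati_weight c ga a b t.
  have E1 : 1 < expR (2 * a * t) by rewrite expR_gt1 !mulr_gt0.
  rewrite /riccati_weight; move: (expR _) E1 => e E1.
  have -> : a * (ga * (1 + s)) * (e / b - (2 * c * (ga * (1 + s)) + b)^-1) / (1 - e)
     = (- ga * (a * (1 + s) / (e - 1))) * (e / b - (2 * c * (ga * (1 + s)) + b)^-1).
    field.
    by rewrite (gt_eqF b0) (lt_eqF B') !subr_eq0 (gt_eqF E1) (lt_eqF E1).
  have -> : (1 + s) * (a * ga * (e / b - (2 * c * ga + b)^-1) / (1 - e))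
     = (- ga * (a * (1 + s) / (e - 1))) * (e / b - (2 * c * ga + b)^-1).
    field.
    by rewrite (gt_eqF b0) (lt_eqF B0) !subr_eq0 (gt_eqF E1) (lt_eqF E1).
  apply: ler_wpM2l.
    rewrite mulr_ge0 ?oppr_ge0 ?(ltW ga0) // divr_ge0 ?mulr_ge0 ?(ltW a0) //; lra.
  rewrite lerD2l lerN2 lef_nV2 ?negrE // lerD2r.
  have : c * ga * s < 0 by rewrite pmulr_llt0.
  by lra.
have : 0 <= al * s ^+ 2 * y by rewrite mulr_ge0 // mulr_ge0 ?sqr_ge0 // ltW.
by rewrite E; lra.
Qed.

Lemma harnack_glued (x : 'rV[R]_n) (t : R) : 0 <= 2 * c * ga + b -> 0 < t ->
  0 <= al * \sum_i q i x t + be * \sum_i p i x t ^+ 2 + ga * expR (2 * l x t)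
       + glued_weight c ga a b ((c * ga + b) / (- (a * c * ga))) t.
Proof.
move=> B0 t0; have W := weight_glued a0 b0 c0 ga0 B0.
have [be_gt0|be_le0] := ltP 0 be.
  exact: (harnack_gradient LS W b0 be_gt0 beal c0 c0 hc hk).
have E : be = 0 by apply/eqP; rewrite eq_le be_le0 be0.
have al0 : 0 < al by rewrite -E.
set S := \sum_i q i x t; set y := \sum_i p i x t ^+ 2; set w := expR _.
have y0 : 0 <= y by apply: sumr_ge0 => i _; exact: sqr_ge0.
apply: (@ge0_of_perturbation _ _ (- (al * S) + al * y)) => s s0 s1.
have [be'0 be'al] := perturbed_bounds s0 s1 E.
have cga : c * ga < 0 by rewrite pmulr_rlt0.
(* Here [ga] stays fixed, since changing it could violate [B0]; the positivity of [c * ga + b]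
   already absorbs the loss. *)
have hk' : 0 <= 2 * c * (al * s * (1 - s)) * ga - 4 * b * (al * (1 - s))
    - 2 * b * (al * s * (1 - s)) - 6 * ga.
  have hk0 := hk; rewrite E !mulr0 mul0r subr0 sub0r in hk0.
  have h1 : 0 <= (c * ga + b) * (al * s * (1 - s)).
    by apply: mulr_ge0; [lra | exact: ltW].
  have h2 : 0 <= b * al * s ^+ 2.
    by rewrite mulr_ge0 ?sqr_ge0 // mulr_ge0 // ltW.
  by lra.
have := harnack_gradient LS W b0 be'0 be'al c0 c0 (perturbed_scale s E) hk' x t0.
rewrite -/S -/y -/w => h.
have : 0 <= al * s ^+ 2 * y by rewrite mulr_ge0 // mulr_ge0 ?sqr_ge0 // ltW.
by rewrite E; lra.
Qed.

End Nonnegative.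

Theorem theorem1p1 (R : realType) (n : nat) (a b : R)
    (f : 'rV[R]_n -> R -> R) (alpha beta gamma : R)
    (hn : (1 <= n)%N) (ha : 0 < a) (hb : 0 < b)
    (hf : classical_NW_solution a b f)
    (hpos : forall (x : 'rV[R]_n) (t : R), 0 <= t -> 0 < f x t)
    (hA : 0 <= beta /\ beta < alpha)
    (hB : let bound :=
            - (n%:R * b * alpha ^+ 2 * (2 * alpha + beta)) /
            (3 * n%:R * alpha ^+ 2 - 2 * (alpha - beta) * beta) in
          gamma <= bound /\ bound < 0) :
  let l := fun (x : 'rV[R]_n) (t : R) => ln (f x t) in
  (4 * gamma * (alpha - beta) + n%:R * alpha ^+ 2 * b < 0 ->
   forall (x : 'rV[R]_n) (t : R), 0 < t ->
     0 <= alpha * laplacian (l^~ t) x + beta * sqnorm2 (grad (l^~ t) x)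
          + gamma * expR (2 * l x t) + phi n a b alpha beta gamma t) /\
  (0 <= 4 * gamma * (alpha - beta) + n%:R * alpha ^+ 2 * b ->
   forall (x : 'rV[R]_n) (t : R), 0 < t ->
     0 <= alpha * laplacian (l^~ t) x + beta * sqnorm2 (grad (l^~ t) x)
          + gamma * expR (2 * l x t) + psi n a b alpha beta gamma t).
Proof.
move=> l; have [be0 beal] := hA; have al0 : 0 < alpha by apply: le_lt_trans beal.
have n0 : 0 < n%:R :> R by rewrite ltr0n.
have na0 : 0 < n%:R * alpha ^+ 2 by rewrite mulr_gt0 // exprn_gt0.
pose P := n%:R * b * alpha ^+ 2 * (2 * alpha + beta).
pose D := 3 * n%:R * alpha ^+ 2 - 2 * (alpha - beta) * beta.
have P0 : 0 < P by rewrite /P !mulr_gt0 ?exprn_gt0 //; lra.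
have [gaP PD0] : gamma <= - P / D /\ - P / D < 0 := hB.
have ga0 : gamma < 0 by apply: le_lt_trans gaP PD0.
(* The numerator of the bound is negative, so negativity of the bound fixes the sign of the
   denominator. *)
have D0 : 0 < D.
  by move: PD0; rewrite mulNr oppr_lt0 pmulr_rgt0 // invr_gt0.
pose c := 2 * (alpha - beta) / (n%:R * alpha ^+ 2).
have c0 : 0 < c by rewrite divr_gt0 // mulr_gt0 // subr_gt0.
have hc : c * alpha ^+ 2 * n%:R = 2 * (alpha - beta).
  by rewrite -mulrA [alpha ^+ 2 * _]mulrC divfK // gt_eqF.
(* After multiplication by [n alpha^2] this is twice hypothesis (b) with its denominator cleared. *)
have hk : 0 <= 2 * c * beta * gamma - 4 * b * alpha - 2 * b * beta - 6 * gamma.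
  rewrite -(pmulr_rge0 _ na0).
  have -> : n%:R * alpha ^+ 2 *
      (2 * c * beta * gamma - 4 * b * alpha - 2 * b * beta - 6 * gamma)
    = 2 * beta * gamma * (c * alpha ^+ 2 * n%:R)
      - n%:R * alpha ^+ 2 * (4 * b * alpha + 2 * b * beta + 6 * gamma) by ring.
  by rewrite hc; move: gaP; rewrite ler_pdivlMr // /P /D; lra.
have hBE : 4 * gamma * (alpha - beta) + n%:R * alpha ^+ 2 * b
    = n%:R * alpha ^+ 2 * (2 * c * gamma + b).
  have -> : n%:R * alpha ^+ 2 * (2 * c * gamma + b)
    = 2 * gamma * (c * alpha ^+ 2 * n%:R) + n%:R * alpha ^+ 2 * b by ring.
  by rewrite hc; ring.
have LS := log_solution_ln hf hpos.
have gradE i t : 0 < t -> pderiv i (l^~ t) = fun x => pderiv i (f^~ t) x / f x t.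
  by move=> t0; apply/funext; exact: (line_derive (ls_dx LS i t0)).
have lapE x t : 0 < t -> laplacian (l^~ t) x =
    \sum_i (pderiv i (pderiv i (f^~ t)) x / f x t - (pderiv i (f^~ t) x / f x t) ^+ 2).
  move=> t0; apply: eq_bigr => i _; rewrite gradE //.
  exact: (line_derive (ls_dxx LS i t0)).
have sqE x t : 0 < t -> sqnorm2 (grad (l^~ t) x) =
    \sum_i (pderiv i (f^~ t) x / f x t) ^+ 2.
  by move=> t0; apply: eq_bigr => i _; rewrite mxE gradE.
have nn0 : n%:R != 0 :> R by rewrite gt_eqF.
have aln0 : alpha != 0 by rewrite gt_eqF.
split=> [|] hcd x t t0; rewrite lapE // sqE //.
  have B0 : 2 * c * gamma + b < 0 by move: hcd; rewrite hBE pmulr_rlt0.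
  have -> : phi n a b alpha beta gamma t = riccati_weight c gamma a b t.
    rewrite /phi /riccati_weight.
    have -> : 4 * gamma * (alpha - beta) + alpha ^+ 2 * b * n%:R
        = n%:R * alpha ^+ 2 * (2 * c * gamma + b) by rewrite -hBE; ring.
    move: (2 * c * gamma + b) B0 ((1 - _)^-1) => B B0 i.
    by field; rewrite nn0 aln0 (gt_eqF hb) (lt_eqF B0).
  exact: (harnack_riccati LS hn ha hb be0 beal c0 ga0 hc hk x B0 t0).
have B0 : 0 <= 2 * c * gamma + b by move: hcd; rewrite hBE pmulr_rge0.
have -> : psi n a b alpha beta gamma t
    = glued_weight c gamma a b ((c * gamma + b) / (- (a * c * gamma))) t.
  have albe : alpha - beta != 0 by rewrite subr_eq0 gt_eqF.
  have TE : switch_time n a b alpha beta gamma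
      = (c * gamma + b) / (- (a * c * gamma)).
    rewrite /switch_time /c; field.
    by rewrite nn0 aln0 albe (gt_eqF ha) (lt_eqF ga0).
  rewrite /psi /glued_weight TE; set T := _ / - _; case: ifP => _.
    by rewrite /c; field; rewrite nn0 aln0 albe (gt_eqF t0).
  rewrite /late_weight; move: (expR _) (expR_gt0 (2 * a * (t - T))) => E E0.
  have den : 0 < b * (E + 1) + 2 * c * gamma by have := mulr_gt0 hb E0; lra.
  have -> : n%:R * alpha ^+ 2 * b * (E + 1) + 4 * gamma * (alpha - beta)
      = n%:R * alpha ^+ 2 * (b * (E + 1) + 2 * c * gamma).
    by have := hBE; lra.
  by move: (b * _ + _) den => d den; field; rewrite nn0 aln0 (gt_eqF den).
exact: (harnack_glued LS ha hb be0 beal c0 ga0 hc hk x B0 t0).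
Qed.
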